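(* Let $(M,\boldsymbol{g})$ be an $n$-dimensional manifold with metric of arbitrary signature, let $2\le p<n$, and let $\boldsymbol{Y}$ be a conformal Killing-Yano (CKY) tensor of order $p$ on $M$. Write $E=e_3e_4\cdots e_p$ and define, in terms of the Weyl tensor $C$, $$W_{cdE}=\frac{p}{2(n-p)}\,C^{a\hat f}{}_{\hat e(c}\,Y_{d)a\hat F}.$$ Then the following identity holds on $M$: $$\begin{aligned} 0={}& C^f{}_{acb}Y_{dfE}+C^f{}_{bda}Y_{cfE}+C^f{}_{cad}Y_{bfE}+C^f{}_{dbc}Y_{afE}+C^{\hat f}{}_{\hat e[bc}Y_{d]a\hat F}+2\,C^{\hat f}{}_{\hat e a[b}Y_{cd]\hat F}\\ &+2\,C^{\hat f}{}_{\hat e bc}Y_{ad\hat F}-3\,C^{\hat f}{}_{\hat e[ab}Y_{c]d\hat F}+\frac{2}{p}\left(g_{ac}W_{bdE}+g_{bd}W_{acE}-g_{ab}W_{cdE}-g_{cd}W_{abE}\right)\\ &+\frac{2(p-2)}{3p}\Big[W_{dcb[e_4\cdots e_p}g_{e_3]a}-W_{dbc[e_4\cdots e_p}g_{e_3]a}+W_{cda[e_4\cdots e_p}g_{e_3]b}-W_{cad[e_4\cdots e_p}g_{e_3]b}\\ &\qquad+W_{bad[e_4\cdots e_p}g_{e_3]c}-W_{bda[e_4\cdots e_p}g_{e_3]c}+W_{abc[e_4\cdots e_p}g_{e_3]d}-W_{acb[e_4\cdots e_p}g_{e_3]d}\Big]. \end{aligned}$$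
   Context: $\nabla$ is the Levi-Civita connection of $\boldsymbol g$. Square (round) brackets denote normalized (weight one) antisymmetrization (symmetrization) over the enclosed free indices. A totally skew-symmetric tensor $\boldsymbol Y$ of rank $p$ is a CKY tensor of order $p$ if there is a skew-symmetric tensor $\boldsymbol h$ of rank $p-1$ such that $$\nabla_a Y_{b_1b_2\cdots b_p}+\nabla_{b_1}Y_{ab_2\cdots b_p}=2g_{a[b_1}h_{b_2\cdots b_p]}+2g_{b_1[a}h_{b_2\cdots b_p]}.$$ The Riemann tensor is fixed by $(\nabla_a\nabla_b-\nabla_b\nabla_a)V_c=R_{abc}{}^{f}V_f$; the Ricci tensor is $R^a{}_b=R^{ca}{}_{cb}$; $C_{abcd}$ is the Weyl tensor, i.e. the totally trace-free part of $R_{abcd}$. Collective indices: $E=e_3e_4\cdots e_p$ is a block of $p-2$ indices, so $Y_{cdE}=Y_{cde_3\cdots e_p}$. When the pair $\hat e$, $\hat f$, $\hat F$ occurs, a sum over the position in the block is understood, with the index $e_i$ of $Y$ replaced by the contracted index $f$; e.g. $$C^{\hat f}{}_{\hat e bc}\,Y_{ad\hat F}=\sum_{i=3}^{p}C^{f}{}_{e_i bc}\,Y_{ad e_3\cdots e_{i-1}fe_{i+1}\cdots e_p},$$ $$C^{a\hat f}{}_{\hat e c}\,Y_{da\hat F}=\sum_{i=3}^{p}C^{af}{}_{e_i c}\,Y_{da e_3\cdots e_{i-1}fe_{i+1}\cdots e_p}.$$ In terms such as $C^{\hat f}{}_{\hat e[bc}Y_{d]a\hat F}$ the antisymmetrization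 involves only $b,c,d$ and not $\hat e$; in terms such as $W_{dcb[e_4\cdots e_p}g_{e_3]a}$ the antisymmetrization is over the indices $e_4,\dots,e_p,e_3$, in this order. For $p=2$ the block $E$ is empty, all terms containing $\hat e$ or indices $e_i$ are absent, and $W=0$. *)

(* Defs.v *)
From HB Require Import structures.
From mathcomp Require Import all_boot all_order all_algebra perm.
From mathcomp Require Import all_classical all_reals topology normedtype derive.

Set Implicit Arguments.
Unset Strict Implicit.
Unset Printing Implicit Defensive.
Import Order.TTheory GRing.Theory Num.Theory numFieldNormedType.Exports.
Local Open Scope classical_set_scope.
Local Open Scope ring_scope.

Section Smooth.
Variables (R : realType) (n : nat).

Definition partial (k : 'I_n) (f : 'rV[R]_n -> R) (u : 'rV[R]_n) : R :=
  'D_(delta_mx 0 k) (f : 'rV[R]_n -> R^o) u.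

(* [Cn m U f]: f is of class C^m on U. All uses have U open, so the values of
   f outside U are irrelevant. *)
Fixpoint Cn (m : nat) (U : set 'rV[R]_n) (f : 'rV[R]_n -> R) : Prop :=
  (forall u, U u -> {for u, continuous f}) /\
  if m is m'.+1 then
    forall k : 'I_n,
      (forall u, U u -> derivable (f : 'rV[R]_n -> R^o) u (delta_mx 0 k)) /\
      Cn m' U (partial k f)
  else True.

Definition smooth_on (U : set 'rV[R]_n) (f : 'rV[R]_n -> R) : Prop :=
  forall m, Cn m U f.

End Smooth.

(* A smooth n-manifold, given by a (not necessarily maximal) smooth atlas.
   [coord i] and [icoord i] are mutually inverse homeomorphisms between the
   open sets [cdom i] of the manifold and [cimg i] of R^n; their values
   outside these sets are irrelevant. *)
Record smoothManifold (R : realType) (n : nat) := SmoothManifold {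
  carrier :> topologicalType ;
  mfd_hausdorff : hausdorff_space carrier ;
  mfd_second_countable : @second_countable carrier ;
  chart : Type ;
  cdom : chart -> set carrier ;
  cimg : chart -> set 'rV[R]_n ;
  coord : chart -> carrier -> 'rV[R]_n ;
  icoord : chart -> 'rV[R]_n -> carrier ;
  cdom_open : forall i, open (cdom i) ;
  cimg_open : forall i, open (cimg i) ;
  coord_img : forall i x, cdom i x -> cimg i (coord i x) ;
  icoord_dom : forall i u, cimg i u -> cdom i (icoord i u) ;
  coordK : forall i x, cdom i x -> icoord i (coord i x) = x ;
  icoordK : forall i u, cimg i u -> coord i (icoord i u) = u ;
  coord_continuous : forall i x, cdom i x -> {for x, continuous (coord i)} ;
  icoord_continuous : forall i u, cimg i u -> {for u, continuous (icoord i)} ;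
  charts_cover : forall x, exists i, cdom i x ;
  transition_smooth : forall i j (k : 'I_n),
    smooth_on [set u | cimg i u /\ cdom j (icoord i u)]
              (fun u => coord j (icoord i u) 0 k)
}.

(* Jacobian d x_j^a / d x_i^b of the transition from chart i to chart j. *)
Definition jac (R : realType) (n : nat) (M : smoothManifold R n)
    (i j : chart M) (u : 'rV[R]_n) (a b : 'I_n) : R :=
  partial b (fun v => coord j (icoord i v) 0 a) u.

(* A smooth covariant tensor field of rank k, given by its components in each
   chart as functions of the coordinates. A component is indexed by the
   sequence of its k indices; values at sequences of other lengths are
   irrelevant. *)
Record tensorField (R : realType) (n : nat) (M : smoothManifold R n)
    (k : nat) := TensorField {
  comp :> chart M -> 'rV[R]_n -> seq 'I_n -> R ;
  comp_smooth : forall i (B : k.-tuple 'I_n),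
    smooth_on (cimg i) (fun u => comp i u B) ;
  comp_transf : forall i j u, cimg i u -> cdom j (icoord i u) ->
    forall B : k.-tuple 'I_n,
      comp i u B = \sum_(A : k.-tuple 'I_n)
        (\prod_(m < k) jac i j u (tnth A m) (tnth B m)) *
        comp j (coord j (icoord i u)) A
}.

Definition skew (R : realType) (n : nat) (M : smoothManifold R n) (k : nat)
    (T : tensorField M k) : Prop :=
  forall i u, cimg i u -> forall (B : k.-tuple 'I_n) (s : 'S_k),
    T i u [tuple tnth B (s m) | m < k] = (-1) ^+ s * T i u B.

Record metric (R : realType) (n : nat) (M : smoothManifold R n) := Metric {
  metric_tensor :> tensorField M 2 ;
  metric_sym : forall i u, cimg i u -> forall a b : 'I_n,
    metric_tensor i u [:: a; b] = metric_tensor i u [:: b; a] ;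
  metric_nondegenerate : forall i u, cimg i u ->
    \matrix_(a < n, b < n) metric_tensor i u [:: a; b] \in unitmx
}.

Definition metric_mx (R : realType) (n : nat) (M : smoothManifold R n)
    (g : metric M) (i : chart M) (u : 'rV[R]_n) : 'M[R]_n :=
  \matrix_(a, b) g i u [:: a; b].

Section IndexCalculus.
Variables (R : realType) (n : nat).
Implicit Types (T F : seq 'I_n -> R) (E : seq 'I_n).

(* Weight-one antisymmetrization of F over all of the indices listed in s. *)
Definition alt F (s : seq 'I_n) : R :=
  (size s)`!%:R^-1 *
  \sum_(q : 'S_(size s))
    (-1) ^+ q * F [tuple tnth (in_tuple s) (q m) | m < size s].

Definition alt3 (F : 'I_n -> 'I_n -> 'I_n -> R) (x y z : 'I_n) : R :=
  alt (fun s => if s is [:: x'; y'; z'] then F x' y' z' else 0) [:: x; y; z].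

(* A^f_{e_i} T_{... f ...}, summed over f and over the position i in the block
   E, f being put in place of e_i: the hatted-index convention. *)
Definition slot_sum (A : 'I_n -> 'I_n -> R) T E : R :=
  \sum_(i < size E) \sum_(f < n)
    A f (tnth (in_tuple E) i) * T (set_nth f E i f).

End IndexCalculus.

(* Geometry of the metric with component matrix G, in one coordinate chart. *)
Section ChartGeometry.
Variables (R : realType) (n : nat) (G : 'rV[R]_n -> 'M[R]_n).
Implicit Types (u : 'rV[R]_n).

Definition ginv u : 'M[R]_n := invmx (G u).

(* Gamma^k_{ab} of the Levi-Civita connection. *)
Definition christoffel u (k a b : 'I_n) : R :=
  2^-1 * \sum_(l < n) ginv u k l *
    (partial a (fun v => G v l b) u + partial b (fun v => G v l a) u
     - partial l (fun v => G v a b) u).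

(* (nabla T) [:: a, b_1, ..., b_k] = nabla_a T_{b_1 ... b_k}. *)
Definition nabla (T : 'rV[R]_n -> seq 'I_n -> R) u (s : seq 'I_n) : R :=
  if s is a :: B then
    partial a (fun v => T v B) u
    - slot_sum (fun f b => christoffel u f a b) (T u) B
  else 0.

Definition dx (f : 'I_n) (u : 'rV[R]_n) (s : seq 'I_n) : R := (s == [:: f])%:R.

(* R_{abc}^f, from (nabla_a nabla_b - nabla_b nabla_a) V_c = R_{abc}^f V_f
   with V the coordinate covector field dx^f. *)
Definition riemann u (a b c f : 'I_n) : R :=
  nabla (nabla (dx f)) u [:: a; b; c] - nabla (nabla (dx f)) u [:: b; a; c].

Definition riemann_low u (a b c d : 'I_n) : R :=
  \sum_(f < n) riemann u a b c f * G u f d.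

(* R_{ab} = R^c_{acb}. *)
Definition ricci u (a b : 'I_n) : R :=
  \sum_(c < n) \sum_(d < n) ginv u c d * riemann_low u d a c b.

Definition scalar_curvature u : R :=
  \sum_(a < n) \sum_(b < n) ginv u a b * ricci u a b.

(* The totally trace-free part of R_{abcd}, given by the Ricci decomposition
   (for n >= 3). *)
Definition weyl u (a b c d : 'I_n) : R :=
  riemann_low u a b c d
  - (n%:R - 2)^-1 *
      (G u a c * ricci u d b - G u a d * ricci u c b
       - G u b c * ricci u d a + G u b d * ricci u c a)
  + scalar_curvature u / ((n%:R - 1) * (n%:R - 2)) *
      (G u a c * G u d b - G u a d * G u c b).

(* C^f_{abc}. *)
Definition weyl_up1 u (f a b c : 'I_n) : R :=
  \sum_(k < n) ginv u f k * weyl u k a b c.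

(* C^{af}_{bc}. *)
Definition weyl_up2 u (a f b c : 'I_n) : R :=
  \sum_(k < n) \sum_(l < n) ginv u a k * ginv u f l * weyl u k l b c.

(* W_{cdE}, for a p-form with components Y at u. *)
Definition Wtensor (p : nat) u (Y : seq 'I_n -> R) (c d : 'I_n)
    (E : seq 'I_n) : R :=
  let S x y := \sum_(a < n)
    slot_sum (fun f e => weyl_up2 u a f e x) (fun F => Y (y :: a :: F)) E in
  p%:R / (2 * (n%:R - p%:R)) * (2^-1 * (S c d + S d c)).

End ChartGeometry.

Definition is_CKY (R : realType) (n : nat) (M : smoothManifold R n)
    (g : metric M) (p : nat) (Y : tensorField M p) : Prop :=
  skew Y /\
  exists h : tensorField M p.-1, skew h /\
    forall i u, cimg i u -> forall (a b : 'I_n) (B : p.-1.-tuple 'I_n),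
      (* the tensor g_{x s_1} h_{s_2 ... s_p} *)
      let gh x s := if s is y :: s' then g i u [:: x; y] * h i u s' else 0 in
      nabla (metric_mx g i) (Y i) u (a :: b :: B)
      + nabla (metric_mx g i) (Y i) u (b :: a :: B)
      = 2 * alt (gh a) (b :: B) + 2 * alt (gh b) (a :: B).

(* Main.v *)
Require Import Defs.
From HB Require Import structures.
From mathcomp Require Import all_boot all_order all_algebra perm.
From mathcomp Require Import all_classical all_reals topology normedtype derive.
From mathcomp Require Import ring lra zify.

Set Implicit Arguments.
Unset Strict Implicit.
Unset Printing Implicit Defensive.
Import Order.TTheory GRing.Theory Num.Theory numFieldNormedType.Exports.
Local Open Scope ring_scope.

(** The CKY equation is a Killing-type equation, so the second derivative
    [nabla_c nabla_a Y_b...] can be solved for cyclically in terms of the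
    curvature acting on [Y] and of [nabla h]. Its skewness in [b] and the next
    index is an algebraic condition which involves [nabla h] only through
    [S_cd = nabla_c h_d... + nabla_d h_c...]. The Schouten part of the curvature
    is absorbed by a shift of [S], leaving the same condition for the Weyl
    tensor. Its double trace shows that the shifted [S] is trace-free, its
    single trace that it equals [W]. The condition has the pair symmetries of
    a curvature tensor in its four distinguished indices, and the stated
    identity is [-1/3] times its antisymmetrization in [b] and [c]. *)

(** * Slot sums and alternating sums *)

(** Solving for [nabla_c nabla_a Y_b...] is the algebra of the Koszul formula: the CKY equation
    supplies the part symmetric in a and b, the Ricci identity the part skew in c and a. The shift
    of S exists because the Schouten part of the curvature is a product of the metric with a
    symmetric tensor, and the curvature terms of such a product have exactly the shape of the metric
    terms. Afterwards only the symmetry of S, its skewness in the block and the condition itself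
    matter; the two traces carry the coefficients n - p + 1 and n - p up to constants, both nonzero
    since p < n. The constant -1/3 comes from the first Bianchi identity: antisymmetrizing a
    symmetrized curvature term returns three times the original. The rank is arbitrary, so every
    manipulation of the block E has to be uniform in its length. Hence antisymmetrizations and
    hatted sums are both reduced to [altsum], which peels off one index at a time and allows
    induction on the list. *)

Section SlotCalculus.
Variables (R : realType) (n : nat).
Implicit Types (T : seq 'I_n -> R) (A : 'I_n -> 'I_n -> R) (s E : seq 'I_n).
Implicit Types (P Q : 'I_n -> seq 'I_n -> R).

Lemma slot_sum_nil A T : slot_sum A T [::] = 0.
Proof. by rewrite /slot_sum big_ord0. Qed.

Lemma slot_sum_cons A T e E :
  slot_sum A T (e :: E) =
  \sum_f A f e * T (f :: E) + slot_sum A (fun s => T (e :: s)) E.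
Proof.
rewrite /slot_sum /= big_ord_recl; congr (_ + _).
by apply: eq_bigr => i _; apply: eq_bigr => f _; rewrite !(tnth_nth e).
Qed.

Lemma eq_slot_sum A A' T T' E :
  (forall f e, A f e = A' f e) ->
  (forall s, size s = size E -> T s = T' s) ->
  slot_sum A T E = slot_sum A' T' E.
Proof.
move=> eqA; elim: E T T' => [|e E IH] T T' eqT; first by rewrite !slot_sum_nil.
rewrite !slot_sum_cons; congr (_ + _).
  by apply: eq_bigr => f _; rewrite eqA eqT.
by apply: IH => s szs; apply: eqT; rewrite /= szs.
Qed.

Lemma slot_sumDr A T T' E :
  slot_sum A (fun s => T s + T' s) E = slot_sum A T E + slot_sum A T' E.
Proof.
elim: E T T' => [|e E IH] T T'; first by rewrite !slot_sum_nil addr0.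
rewrite !slot_sum_cons IH addrACA; congr (_ + _).
by rewrite -big_split; apply: eq_bigr => f _; rewrite mulrDr.
Qed.

Lemma slot_sumZr A k T E :
  slot_sum A (fun s => k * T s) E = k * slot_sum A T E.
Proof.
elim: E T => [|e E IH] T; first by rewrite !slot_sum_nil mulr0.
rewrite !slot_sum_cons IH mulrDr mulr_sumr; congr (_ + _).
by apply: eq_bigr => f _; rewrite mulrCA.
Qed.

Lemma slot_sumNr A T E : slot_sum A (fun s => - T s) E = - slot_sum A T E.
Proof.
rewrite -mulN1r -slot_sumZr; apply: eq_slot_sum => // s _.
by rewrite mulN1r.
Qed.

Lemma slot_sumBr A T T' E :
  slot_sum A (fun s => T s - T' s) E = slot_sum A T E - slot_sum A T' E.
Proof. by rewrite slot_sumDr slot_sumNr. Qed.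

Lemma slot_sum_sumr (I : finType) A (T : I -> seq 'I_n -> R) E :
  slot_sum A (fun s => \sum_j T j s) E = \sum_j slot_sum A (T j) E.
Proof.
elim: E T => [|e E IH] T.
  by rewrite slot_sum_nil big1 // => j _; rewrite slot_sum_nil.
rewrite slot_sum_cons IH.
under [RHS]eq_bigr do rewrite slot_sum_cons.
rewrite big_split; congr (_ + _); rewrite exchange_big.
by apply: eq_bigr => f _; rewrite mulr_sumr.
Qed.

Lemma slot_sumDl A A' T E :
  slot_sum (fun f e => A f e + A' f e) T E = slot_sum A T E + slot_sum A' T E.
Proof.
elim: E T => [|e E IH] T; first by rewrite !slot_sum_nil addr0.
rewrite !slot_sum_cons IH addrACA; congr (_ + _).
by rewrite -big_split; apply: eq_bigr => f _; rewrite mulrDl.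
Qed.

Lemma slot_sumNl A T E :
  slot_sum (fun f e => - A f e) T E = - slot_sum A T E.
Proof.
elim: E T => [|e E IH] T; first by rewrite !slot_sum_nil oppr0.
rewrite !slot_sum_cons IH opprD; congr (_ + _).
by rewrite -sumrN; apply: eq_bigr => f _; rewrite mulNr.
Qed.

Lemma slot_sumBl A A' T E :
  slot_sum (fun f e => A f e - A' f e) T E = slot_sum A T E - slot_sum A' T E.
Proof. by rewrite slot_sumDl slot_sumNl. Qed.

(* Distinct slots commute, so only the terms acting twice on the same slot
   survive in the commutator. *)
Lemma slot_sum_commutator A A' T E :
  slot_sum A (slot_sum A' T) E - slot_sum A' (slot_sum A T) E =
  slot_sum (fun f e => \sum_k (A k e * A' f k - A' k e * A f k)) T E.
Proof.
elim: E T => [|e E IH] T; first by rewrite !slot_sum_nil subr0.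
(* Four cases: both operators on the head, the outer one alone on the head, the inner one alone on
   the head, neither on the head. The two middle cases trade places when the operators are
   exchanged, so they drop out of the commutator. *)
have dbl B B' : slot_sum B (slot_sum B' T) (e :: E) =
    \sum_f \sum_k B k e * B' f k * T (f :: E)
  + \sum_f B f e * slot_sum B' (fun s => T (f :: s)) E
  + \sum_f B' f e * slot_sum B (fun s => T (f :: s)) E
  + slot_sum B (slot_sum B' (fun s => T (e :: s))) E.
  rewrite slot_sum_cons.
  under eq_bigr do rewrite slot_sum_cons mulrDr mulr_sumr.
  rewrite big_split /= exchange_big /= -!addrA; congr (_ + (_ + _)).
    by apply: eq_bigr => f _; apply: eq_bigr => k _; rewrite mulrA.
  under [X in _ = X + _]eq_bigr do rewrite -slot_sumZr.
  rewrite -slot_sum_sumr -slot_sumDr; apply: eq_slot_sum => // s _.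
  by rewrite slot_sum_cons.
rewrite !dbl slot_sum_cons -IH.
under [\sum_f (\sum_k (A k e * A' f k - A' k e * A f k)) * _]eq_bigr do
  rewrite sumrB mulrBl !mulr_suml.
rewrite sumrB; ring.
Qed.

Lemma slot_sum_id T E :
  slot_sum (fun f e => (f == e)%:R) T E = (size E)%:R * T E.
Proof.
elim: E T => [|e E IH] T; first by rewrite slot_sum_nil mul0r.
rewrite slot_sum_cons IH (bigD1 e) //= big1 => [|f /negPf->]; last by rewrite mul0r.
by rewrite eqxx mul1r addr0 -natr1 mulrDl mul1r addrC.
Qed.

(** Adjacent transpositions suffice, and asking for them on lists of every length keeps inductions
    free of length conditions. *)
Definition skew_seq T : Prop :=
  forall s1 x y s2, T (s1 ++ x :: y :: s2) = - T (s1 ++ y :: x :: s2).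

Lemma skew_seq_cons T x : skew_seq T -> skew_seq (fun s => T (x :: s)).
Proof. by move=> skT s1 y z s2; apply: (skT (x :: s1)). Qed.

Lemma skew_seq_swap T x y s :
  skew_seq T -> T (x :: y :: s) = - T (y :: x :: s).
Proof. by move=> skT; apply: (skT [::]). Qed.

Lemma slot_sum_skew A T : skew_seq T -> skew_seq (slot_sum A T).
Proof.
move=> skT s1; elim: s1 T skT => [|z s1 IH] T skT x y s2 /=; last first.
  rewrite !slot_sum_cons (IH _ (skew_seq_cons z skT)) opprD; congr (_ + _).
  by rewrite -sumrN; apply: eq_bigr => f _; rewrite (skT (f :: s1)) mulrN.
rewrite !slot_sum_cons !opprD addrCA; congr (_ + (_ + _)).
- by rewrite -sumrN; apply: eq_bigr => f _; rewrite skew_seq_swap // mulrN.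
- by rewrite -sumrN; apply: eq_bigr => f _; rewrite skew_seq_swap // mulrN.
rewrite -slot_sumNr; apply: eq_slot_sum => // s _.
by rewrite skew_seq_swap.
Qed.

(* Unfolds to the sum of (-1)^j P s_j (s without its entry j). *)
Fixpoint altsum P s : R :=
  if s is x :: s' then P x s' - altsum (fun y t => P y (x :: t)) s' else 0.

Lemma eq_altsum P Q s :
  (forall x t, (size t).+1 = size s -> P x t = Q x t) -> altsum P s = altsum Q s.
Proof.
elim: s P Q => //= x s IH P Q eqPQ; rewrite eqPQ //; congr (_ - _).
by apply: IH => y t szt; apply: eqPQ; rewrite /= szt.
Qed.

Lemma altsumD P Q s :
  altsum (fun x t => P x t + Q x t) s = altsum P s + altsum Q s.
Proof. by elim: s P Q => [|x s IH] P Q /=; rewrite ?addr0 // IH; ring. Qed.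

Lemma altsumZ k P s : altsum (fun x t => k * P x t) s = k * altsum P s.
Proof. by elim: s P => [|x s IH] P /=; rewrite ?mulr0 // IH; ring. Qed.

Lemma altsumN P s : altsum (fun x t => - P x t) s = - altsum P s.
Proof. by elim: s P => [|x s IH] P /=; rewrite ?oppr0 // IH; ring. Qed.

Lemma altsumB P Q s :
  altsum (fun x t => P x t - Q x t) s = altsum P s - altsum Q s.
Proof. by rewrite altsumD altsumN. Qed.

Lemma altsum0 s : altsum (fun _ _ => 0) s = 0.
Proof. by elim: s => //= x s ->; rewrite subr0. Qed.

Lemma altsum_sum (I : finType) (P : I -> 'I_n -> seq 'I_n -> R) s :
  altsum (fun x t => \sum_j P j x t) s = \sum_j altsum (P j) s.
Proof.
elim: s P => [|x s IH] P /=; first by rewrite big1.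
by rewrite IH sumrB.
Qed.

(** Moving the contracted index from position j to the front of [T] costs (-1)^j, the sign that
    [altsum] attaches to that position. *)
Lemma slot_sum_altsum A T E : skew_seq T ->
  slot_sum A T E = altsum (fun e t => \sum_k A k e * T (k :: t)) E.
Proof.
elim: E T => [|e E IH] T skT; first by rewrite slot_sum_nil.
rewrite slot_sum_cons IH /=; last exact: skew_seq_cons.
congr (_ + _); rewrite -altsumN; apply: eq_altsum => x t _.
rewrite -sumrN; apply: eq_bigr => k _.
by rewrite skew_seq_swap // mulrN.
Qed.

Lemma altsum_skew T s : skew_seq T ->
  altsum (fun x t => T (x :: t)) s = (size s)%:R * T s.
Proof.
move=> skT; rewrite -slot_sum_id slot_sum_altsum //; apply: eq_altsum => x t _.
rewrite (bigD1 x) //= big1 => [|f /negPf->]; last by rewrite mul0r.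
by rewrite eqxx mul1r addr0.
Qed.

(* A acts as a derivation, so that this is a Leibniz rule. *)
Lemma slot_sum_altsum_mul A (phi : 'I_n -> R) T s :
  slot_sum A (altsum (fun x t => phi x * T t)) s =
  altsum (fun x t => (\sum_f A f x * phi f) * T t) s
  + altsum (fun x t => phi x * slot_sum A T t) s.
Proof.
elim: s T => [|e E IH] T; first by rewrite slot_sum_nil addr0.
rewrite slot_sum_cons /=.
under eq_bigr do rewrite mulrBr.
rewrite sumrB slot_sumBr IH slot_sumZr.
have -> : altsum (fun x t => phi x * slot_sum A T (e :: t)) E =
   \sum_f A f e * altsum (fun y t => phi y * T (f :: t)) E
   + altsum (fun x t => phi x * slot_sum A (fun s => T (e :: s)) t) E.
  under [X in X + _]eq_bigr do rewrite -altsumZ.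
  rewrite -altsum_sum -altsumD; apply: eq_altsum => x t _.
  rewrite slot_sum_cons mulrDr mulr_sumr; congr (_ + _).
  by apply: eq_bigr => f _; rewrite mulrCA.
rewrite mulr_suml; under eq_bigr do rewrite mulrA; ring.
Qed.

End SlotCalculus.

(** * Weight-one antisymmetrization as an alternating sum *)

Section Alternation.
Variables (R : realType) (n : nat).
Implicit Types (F T : seq 'I_n -> R) (s E : seq 'I_n).

Lemma seq_codom s : exists t : 'I_(size s) -> 'I_n, s = codom t.
Proof.
exists (tnth (in_tuple s)).
by rewrite codomE map_tnth_enum.
Qed.

Lemma alt_codom N (t : 'I_N -> 'I_n) F :
  alt F (codom t) =
  N`!%:R^-1 * \sum_(q : 'S_N) (-1) ^+ q * F (codom (t \o q)).
Proof.
suff altE s : size s = N -> codom t = s ->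
    alt F s = N`!%:R^-1 * \sum_(q : 'S_N) (-1) ^+ q * F (codom (t \o q)).
  by apply: altE; rewrite // size_codom card_ord.
move=> sz; case: N / sz t => t st; rewrite /alt.
congr (_ * _); apply: eq_bigr => q _; congr (_ * F _).
rewrite codomE /=; apply: eq_map => j /=.
rewrite (tnth_nth (t j)) /= -[X in nth _ X _]st codomE (nth_map j) ?size_enum_ord //.
by rewrite nth_ord_enum.
Qed.

Lemma codom_ord0 (t : 'I_0 -> 'I_n) : codom t = [::].
Proof. by apply: size0nil; rewrite size_codom card_ord. Qed.

Lemma codom_ordS m (t : 'I_m.+1 -> 'I_n) :
  codom t = t ord0 :: codom (t \o lift ord0).
Proof. by rewrite !codomE enum_ordSl /= -map_comp. Qed.

Lemma altsum_codom m (t : 'I_m.+1 -> 'I_n) P :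
  altsum P (codom t) =
  \sum_(j < m.+1) (-1) ^+ j * P (t j) (codom (t \o lift j)) :> R.
Proof.
elim: m t P => [|m IH] t P; rewrite codom_ordS /=.
  by rewrite big_ord1 expr0 mul1r !codom_ord0 /= subr0.
rewrite [RHS]big_ord_recl expr0 mul1r /=; congr (_ + _).
rewrite IH -sumrN; apply: eq_bigr => j _.
rewrite /bump leq0n add1n exprS mulN1r mulNr; congr (- (_ * P _ _)).
rewrite [in RHS]codom_ordS /=; congr (_ :: _).
  by congr (t _); apply: val_inj.
rewrite !codomE; apply: eq_map => k /=; congr (t _); apply: val_inj => /=.
by rewrite /bump /=; lia.
Qed.

Lemma lift_perm_bij m :
  bijective (fun jq : 'I_m.+1 * 'S_m => lift_perm ord0 jq.1 jq.2).
Proof.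
apply: inj_card_bij => [[j q] [j' q'] /= e|].
  have ej : j = j' by rewrite -(lift_perm_id ord0 j q) e lift_perm_id.
  congr (_, _) => //; apply/permP => k; apply: (@lift_inj _ j).
  by rewrite -(lift_perm_lift ord0) e ej lift_perm_lift.
by rewrite card_prod card_ord !card_Sn factS.
Qed.

(** Permutations are grouped by the position j that is sent to the front; [lift_perm ord0 j]
    contributes the sign (-1)^j, and N! = N (N-1)! splits the weight. *)
Lemma alt_altsum F s : (0 < size s)%N ->
  alt F s =
  (size s)%:R^-1 * altsum (fun x t => alt (fun u => F (x :: u)) t) s.
Proof.
have [t st] := seq_codom s; move: t st.
case: (size s) => // m t -> _.
rewrite alt_codom altsum_codom factS natrM invfM -mulrA; congr (_ * _).
rewrite (reindex _ (onW_bij _ (lift_perm_bij m))) /=.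
rewrite -(pair_bigA _ (fun j q => (-1) ^+ lift_perm ord0 j q *
   F (codom (t \o lift_perm ord0 j q)))) /= mulr_sumr.
apply: eq_bigr => j _; rewrite alt_codom mulrCA; congr (_ * _).
rewrite mulr_sumr; apply: eq_bigr => q _.
rewrite odd_lift_perm /= signr_addb signr_odd -mulrA; congr (_ * (_ * F _)).
rewrite codom_ordS /= lift_perm_id; congr (_ :: _).
by rewrite !codomE; apply: eq_map => k /=; rewrite lift_perm_lift.
Qed.

Lemma alt_nil F : alt F [::] = F [::].
Proof.
have [t e] := seq_codom [::]; rewrite {1}e alt_codom /=.
rewrite fact0 invr1 mul1r (eq_bigr (fun=> F [::])).
  by rewrite sumr_const card_Sn.
move=> q _; rewrite (_ : q = 1%g) ?odd_perm1 ?mul1r ?codom_ord0 //.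
by apply/permP => -[].
Qed.

Lemma eq_alt F F' s :
  (forall t, size t = size s -> F t = F' t) -> alt F s = alt F' s.
Proof.
move=> eqF; have [t e] := seq_codom s; rewrite e !alt_codom.
congr (_ * _); apply: eq_bigr => q _; rewrite eqF //.
by rewrite size_codom card_ord.
Qed.

Lemma alt_mull k F s : alt (fun t => k * F t) s = k * alt F s.
Proof.
rewrite /alt mulrCA; congr (_ * _); rewrite mulr_sumr.
by apply: eq_bigr => q _; rewrite mulrCA.
Qed.

Lemma alt_skew T s : skew_seq T -> alt T s = T s.
Proof.
elim: {s}(size s) {-2}s (erefl (size s)) T => [|m IH] s sz T skT.
  by rewrite (size0nil sz) alt_nil.
rewrite alt_altsum ?sz // (eq_altsum (Q := fun x t => T (x :: t))).
  by rewrite altsum_skew // sz mulKf // pnatr_eq0.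
move=> x t szt; apply: IH; last exact: skew_seq_cons.
by move: szt; rewrite sz => -[].
Qed.

(** This treats g_{a[b}h_{...]} in the CKY equation and the metric terms of the final identity: the
    skew factor needs no further antisymmetrization. *)
Lemma alt_mul_skew (phi : 'I_n -> R) T x s : skew_seq T ->
  alt (fun t => if t is y :: t' then phi y * T t' else 0) (x :: s) =
  (size s).+1%:R^-1 * altsum (fun y t => phi y * T t) (x :: s).
Proof.
move=> skT; rewrite alt_altsum //; congr (_ * _); apply: eq_altsum => y t _.
by rewrite alt_mull alt_skew.
Qed.

Lemma alt3E (F : 'I_n -> 'I_n -> 'I_n -> R) x y z :
  alt3 F x y z = 6^-1 * (F x y z - F x z y - F y x z + F y z x
                         + F z x y - F z y x).
Proof.
rewrite /alt3 alt_altsum //= !alt_altsum //= !alt_altsum //= !alt_nil.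
by field.
Qed.

(** Conjugating a permutation by the cyclic shift preserves its sign. It moves the index e_3, which
    stands last in W_{...[e_4...e_p}g_{e_3]a}, to the front without a sign. *)
Lemma alt_rot F s : alt (fun t => F (rotr 1 t)) (rot 1 s) = alt F s.
Proof.
have [t {1 2}->] := seq_codom s; move: (size s) t => [|m] t.
  by rewrite codom_ord0 /= !alt_nil.
pose c : 'S_m.+1 := perm (@ordS_inj m.+1).
have rotE (t' : 'I_m.+1 -> 'I_n) : rot 1 (codom t') = codom (t' \o c).
  rewrite codom_ordS rot1_cons [in RHS]codomE enum_ordSr map_rcons -map_comp.
  congr rcons; last by rewrite /= permE; congr (t' _); apply: val_inj; rewrite /= modnn.
  rewrite codomE; apply: eq_map => j /=; rewrite permE; congr (t' _).
  by apply: val_inj; rewrite /= modn_small // ltnS.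
rewrite rotE !alt_codom; congr (_ * _).
rewrite [RHS](reindex (fun q : 'S_m.+1 => c^-1 * q * c)%g) /=; last first.
  exists (fun q : 'S_m.+1 => c * q * c^-1)%g => q _.
    by rewrite !mulgA mulgV mul1g mulgK.
  by rewrite !mulgA mulVg mul1g mulgVK.
apply: eq_bigr => q _; rewrite !odd_permM odd_permV addbAC addbb addFb.
congr (_ * F _); rewrite -[RHS](rotK 1) rotE; congr (rotr 1 _).
by rewrite !codomE; apply: eq_map => j /=; rewrite !permM permK.
Qed.

End Alternation.

(** * The integrability condition at a point *)

Section MetricContraction.
Variables (R : realType) (n : nat) (G Gi : 'I_n -> 'I_n -> R).
Hypothesis symG : forall a b, G a b = G b a.
Hypothesis symGi : forall a b, Gi a b = Gi b a.
Hypothesis GiK : forall a b, \sum_k Gi a k * G k b = (a == b)%:R.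
Implicit Types (B : 'I_n -> 'I_n -> R) (T : 'I_n -> R).

(** Trace with the inverse metric. Tensors keep all indices down, and every contraction is a
    [ctr]. *)
Definition ctr B : R := \sum_a \sum_c Gi a c * B a c.

Lemma eq_ctr B B' : (forall a c, B a c = B' a c) -> ctr B = ctr B'.
Proof.
by move=> eqB; apply: eq_bigr => a _; apply: eq_bigr => c _; rewrite eqB.
Qed.

Lemma ctrD B B' : ctr (fun a c => B a c + B' a c) = ctr B + ctr B'.
Proof.
rewrite /ctr -big_split; apply: eq_bigr => a _.
by rewrite -big_split; apply: eq_bigr => c _; rewrite mulrDr.
Qed.

Lemma ctrZ k B : ctr (fun a c => k * B a c) = k * ctr B.
Proof.
rewrite /ctr mulr_sumr; apply: eq_bigr => a _.
by rewrite mulr_sumr; apply: eq_bigr => c _; rewrite mulrCA.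
Qed.

Lemma ctrZr k B : ctr (fun a c => B a c * k) = ctr B * k.
Proof. by rewrite mulrC -ctrZ; apply: eq_ctr => a c; rewrite mulrC. Qed.

Lemma ctrN B : ctr (fun a c => - B a c) = - ctr B.
Proof. by rewrite -mulN1r -ctrZ; apply: eq_ctr => a c; rewrite mulN1r. Qed.

Lemma ctrB B B' : ctr (fun a c => B a c - B' a c) = ctr B - ctr B'.
Proof. by rewrite ctrD ctrN. Qed.

Lemma ctr0 : ctr (fun _ _ => 0) = 0.
Proof. rewrite -[RHS](mul0r (ctr (fun _ _ => 0))) -ctrZ.
by apply: eq_ctr => a c; rewrite mul0r. Qed.

Lemma ctr_swap B : ctr B = ctr (fun a c => B c a).
Proof.
rewrite /ctr exchange_big; apply: eq_bigr => a _; apply: eq_bigr => c _.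
by rewrite symGi.
Qed.

Lemma ctr_exchange (B : 'I_n -> 'I_n -> 'I_n -> 'I_n -> R) :
  ctr (fun a c => ctr (fun k f => B a c k f)) =
  ctr (fun k f => ctr (fun a c => B a c k f)).
Proof.
pose D a c k f := Gi a c * (Gi k f * B a c k f).
have -> : ctr (fun a c => ctr (fun k f => B a c k f)) =
    \sum_a \sum_c \sum_k \sum_f D a c k f.
  apply: eq_bigr => a _; apply: eq_bigr => c _; rewrite mulr_sumr.
  by apply: eq_bigr => k _; rewrite mulr_sumr.
have -> : ctr (fun k f => ctr (fun a c => B a c k f)) =
    \sum_k \sum_f \sum_a \sum_c D a c k f.
  apply: eq_bigr => k _; apply: eq_bigr => f _; rewrite mulr_sumr.
  apply: eq_bigr => a _; rewrite mulr_sumr; apply: eq_bigr => c _.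
  by rewrite mulrCA.
under eq_bigr do rewrite exchange_big.
rewrite exchange_big; apply: eq_bigr => k _.
under eq_bigr do rewrite exchange_big.
by rewrite exchange_big.
Qed.

Lemma ctr_metricr x T : ctr (fun a c => T a * G x c) = T x.
Proof.
rewrite /ctr (bigD1 x) //= [X in _ + X]big1 => [|a /negPf nax].
  under eq_bigr do rewrite mulrCA symG.
  by rewrite -mulr_sumr GiK eqxx mulr1 addr0.
under eq_bigr do rewrite mulrCA symG.
by rewrite -mulr_sumr GiK nax mulr0.
Qed.

Lemma ctr_metric x T : ctr (fun a c => G x a * T c) = T x.
Proof.
by rewrite ctr_swap -[RHS](ctr_metricr x); apply: eq_ctr => a c; rewrite mulrC.
Qed.

Lemma ctr_dim : ctr G = n%:R.
Proof.
rewrite /ctr -[in RHS](card_ord n) -sumr_const; apply: eq_bigr => a _.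
by under eq_bigr do rewrite symG; rewrite GiK eqxx.
Qed.

Lemma altsum_ctr (P : 'I_n -> 'I_n -> 'I_n -> seq 'I_n -> R) s :
  altsum (fun e t => ctr (fun a c => P a c e t)) s =
  ctr (fun a c => altsum (P a c) s).
Proof.
rewrite altsum_sum; apply: eq_bigr => a _.
by rewrite altsum_sum; apply: eq_bigr => c _; rewrite altsumZ.
Qed.

Lemma ctr_skew_swap B (T : 'I_n -> 'I_n -> R) :
  (forall a f, T a f = - T f a) ->
  ctr (fun a c => ctr (fun k f => B c k * T a f)) =
  - ctr (fun a c => ctr (fun k f => B k c * T a f)).
Proof.
move=> skT; rewrite ctr_exchange ctr_swap -ctrN; apply: eq_ctr => a c.
rewrite ctr_swap -ctrN; apply: eq_ctr => k f.
by rewrite [in LHS]skT mulrN.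
Qed.

(** * The curvature and metric parts of the integrability condition *)

Section CurvatureAction.
Variable Y : seq 'I_n -> R.
Hypothesis skY : skew_seq Y.
Implicit Types (K C : 'I_n -> 'I_n -> 'I_n -> 'I_n -> R) (P : 'I_n -> 'I_n -> R).
Implicit Types (S : 'I_n -> 'I_n -> seq 'I_n -> R).

(* K_{xyz}^f Y_{wfE} *)
Definition head_term K x y z w E : R :=
  ctr (fun k f => K x y z k * Y (w :: f :: E)).

(* K_{xye}^f Y_{zwft} *)
Definition block_term K x y z w e t : R :=
  ctr (fun k f => K x y e k * Y (z :: w :: f :: t)).

(* [curv_op] and [metric_op] are the parts of the integrability condition
   linear in the curvature and in S_cd = nabla_c h_d + nabla_d h_c. *)
Definition curv_op K a c b d E : R :=
  head_term K b c d a E + head_term K d c b a E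
  + head_term K b a d c E + head_term K d a b c E
  + head_term K a d c b E + head_term K c d a b E
  + head_term K a b c d E + head_term K c b a d E
  - altsum (fun e t =>
      block_term K c b a d e t + block_term K a b c d e t
      + block_term K c d a b e t + block_term K a d c b e t) E.

Definition metric_op S a c b d E : R :=
  G a b * S c d E + G a d * S b c E + G c d * S a b E + G b c * S a d E
  - 2 * (G b d * S a c E) - 2 * (G a c * S b d E)
  + altsum (fun e t =>
      G c e * S b d (a :: t) + G a e * S b d (c :: t)
      + G b e * S a c (d :: t) + G d e * S a c (b :: t)) E.

(** The Kulkarni-Nomizu product of [G] and [P]. *)
Definition kn P a b c d : R :=
  G a c * P b d - G a d * P b c - G b c * P a d + G b d * P a c.

Definition contr1 P x y s : R := ctr (fun k f => P x k * Y (y :: f :: s)).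

Lemma ctr_kn P x y z T :
  ctr (fun k f => kn P x y z k * T f) =
  G x z * ctr (fun k f => P y k * T f) - P y z * T x
  - G y z * ctr (fun k f => P x k * T f) + P x z * T y.
Proof.
rewrite -(ctr_metric x T) -(ctr_metric y T) -!ctrZ -!ctrB -ctrD.
by apply: eq_ctr => k f; rewrite /kn; ring.
Qed.

Lemma head_term_kn P x y z w E :
  head_term (kn P) x y z w E =
  G x z * contr1 P y w E - P y z * Y (w :: x :: E)
  - G y z * contr1 P x w E + P x z * Y (w :: y :: E).
Proof. exact: (ctr_kn P x y z (fun f => Y (w :: f :: E))). Qed.

Lemma block_term_kn P x y z w e t :
  block_term (kn P) x y z w e t =
  - (G x e * contr1 P y z (w :: t)) - P y e * Y (z :: w :: x :: t)
  + G y e * contr1 P x z (w :: t) + P x e * Y (z :: w :: y :: t).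
Proof.
have cE v : ctr (fun k f => P v k * Y (z :: w :: f :: t)) =
    - contr1 P v z (w :: t).
  rewrite -ctrN; apply: eq_ctr => k f.
  by rewrite (skY [:: z]) mulrN.
by rewrite /block_term (ctr_kn P x y e (fun f => Y (z :: w :: f :: t))) !cE; ring.
Qed.

Lemma contr1_swap P x z w t : contr1 P x z (w :: t) = - contr1 P x w (z :: t).
Proof.
rewrite -ctrN; apply: eq_ctr => k f; rewrite -mulrN; congr (_ * _).
by rewrite (skY [:: z] f w t) /= (skew_seq_swap z w _ skY) (skY [:: w] z f t) opprK.
Qed.

(** Each term of [kn] contains a metric factor, which either survives beside a contraction P_x^f
    Y_{yf...} or is used up by the contraction with [Y]. The former assemble into [metric_op], the
    latter cancel. *)
Lemma curv_op_kn P a c b d E : (forall x y, P x y = P y x) ->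
  curv_op (kn P) a c b d E =
  - metric_op (fun x y s => contr1 P x y s + contr1 P y x s) a c b d E.
Proof.
move=> symP; rewrite /curv_op /metric_op.
set F := fun e t => block_term _ _ _ _ _ e t + _ + _ + _.
set F' := fun e t => G c e * _ + _ + _ + _.
have -> : altsum F E = altsum F' E.
  apply: eq_altsum => e t _; rewrite /F /F' !block_term_kn.
  rewrite (contr1_swap P b c d) (contr1_swap P d c b) (contr1_swap P b a d).
  rewrite (contr1_swap P d a b) (contr1_swap P c a d) (contr1_swap P a c d).
  (* The products of [P _ e] with [Y] have no counterpart in [metric_op]; they cancel once the three
     leading indices of [Y] are brought to a common order. *)
  have Y1 x y z : Y (x :: y :: z :: t) = - Y (y :: x :: z :: t).
    by rewrite skew_seq_swap.
  have Y2 x y z : Y (x :: y :: z :: t) = - Y (x :: z :: y :: t).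
    by rewrite (skY [:: x]).
  rewrite (Y1 a d c) (Y2 d a c) (Y1 a d b) (Y1 c d b) (Y1 c d a).
  rewrite (Y1 c b d) (Y2 b c d) (Y1 a b c) (Y2 b a c) (Y1 a b d) (Y2 b a d).
  rewrite (Y1 c b a) (Y2 d c b) (Y2 d a b) (Y1 d b a) (Y1 d b c).
  ring.
rewrite !head_term_kn.
rewrite (symG d c) (symG b a) (symG d a) (symG d b) (symG c b) (symG c a).
rewrite (symP d c) (symP b a) (symP d a) (symP d b) (symP c b) (symP c a).
rewrite (skew_seq_swap d c _ skY) (skew_seq_swap b a _ skY).
rewrite (skew_seq_swap d a _ skY) (skew_seq_swap d b _ skY).
rewrite (skew_seq_swap c b _ skY) (skew_seq_swap c a _ skY).
ring.
Qed.


Lemma curv_opD K K1 K2 a c b d E :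
  (forall x y z w, K x y z w = K1 x y z w + K2 x y z w) ->
  curv_op K a c b d E = curv_op K1 a c b d E + curv_op K2 a c b d E.
Proof.
move=> eqK.
have hD x y z w : head_term K x y z w E =
    head_term K1 x y z w E + head_term K2 x y z w E.
  by rewrite -ctrD; apply: eq_ctr => k f; rewrite eqK mulrDl.
have bD x y z w e t : block_term K x y z w e t =
    block_term K1 x y z w e t + block_term K2 x y z w e t.
  by rewrite -ctrD; apply: eq_ctr => k f; rewrite eqK mulrDl.
rewrite /curv_op !hD; set F := fun e t => _; set F1 := fun e t => _.
set F2 := fun e t => _.
have -> : altsum F E = altsum F1 E + altsum F2 E.
  by rewrite -altsumD; apply: eq_altsum => e t _; rewrite /F !bD /F1 /F2; ring.
ring.
Qed.

Lemma metric_opD S S1 S2 a c b d E :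
  (forall x y s, S x y s = S1 x y s + S2 x y s) ->
  metric_op S a c b d E = metric_op S1 a c b d E + metric_op S2 a c b d E.
Proof.
move=> eqS; rewrite /metric_op !eqS; set F := fun e t => _.
set F1 := fun e t => _; set F2 := fun e t => _.
have -> : altsum F E = altsum F1 E + altsum F2 E.
  by rewrite -altsumD; apply: eq_altsum => e t _; rewrite /F !eqS /F1 /F2; ring.
ring.
Qed.

Lemma metric_opZ k S a c b d E :
  metric_op (fun x y s => k * S x y s) a c b d E = k * metric_op S a c b d E.
Proof.
rewrite /metric_op; set F := fun e t => _; set F1 := fun e t => _.
have -> : altsum F E = k * altsum F1 E.
  by rewrite -altsumZ; apply: eq_altsum => e t _; rewrite /F /F1; ring.
ring.
Qed.

(** In the factor of [S b d E], 4 comes from the four mixed metric terms, -2n from the trace of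
    [G a c], and twice the size of E from the two block terms that reinsert the removed entry e. *)
Lemma ctr_metric_op S b d E :
  (forall x y s, S x y s = S y x s) ->
  (forall x y, skew_seq (S x y)) ->
  let tau s := ctr (fun a c => S a c s) in
  ctr (fun a c => metric_op S a c b d E) =
  (4 - 2 * n%:R + 2 * (size E)%:R) * S b d E - 2 * (G b d * tau E)
  + altsum (fun e t => G b e * tau (d :: t) + G d e * tau (b :: t)) E.
Proof.
move=> symS skS tau; rewrite /metric_op ctrD -altsum_ctr.
have -> : altsum (fun e t => ctr (fun a c =>
      G c e * S b d (a :: t) + G a e * S b d (c :: t)
      + G b e * S a c (d :: t) + G d e * S a c (b :: t))) E =
    2 * (size E)%:R * S b d E
    + altsum (fun e t => G b e * tau (d :: t) + G d e * tau (b :: t)) E.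
  rewrite -mulrA -altsum_skew // -altsumZ -altsumD; apply: eq_altsum => e t _.
  rewrite !ctrD !ctrZ -addrA; congr (_ + _).
  under eq_ctr do rewrite mulrC symG.
  rewrite ctr_metricr; under [X in _ + X]eq_ctr do rewrite symG.
  by rewrite ctr_metric; ring.
rewrite !ctrB !ctrD !ctrZ ctrZr ctr_dim.
have -> : ctr (fun a c => G a b * S c d E) = S b d E.
  by under eq_ctr do rewrite symG; rewrite ctr_metric.
have -> : ctr (fun a c => G a d * S b c E) = S b d E.
  by under eq_ctr do rewrite symG; rewrite (ctr_metric d (S b ^~ E)).
have -> : ctr (fun a c => G c d * S a b E) = S b d E.
  under eq_ctr do rewrite symG mulrC symS.
  by rewrite (ctr_metricr d (S b ^~ E)).
have -> : ctr (fun a c => G b c * S a d E) = S b d E.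
  by under eq_ctr do rewrite mulrC; rewrite ctr_metricr.
rewrite -/(tau E); ring.
Qed.

(** * Traces of the integrability condition for a trace-free curvature tensor *)

Section TraceFree.
Variable C : 'I_n -> 'I_n -> 'I_n -> 'I_n -> R.
Hypothesis CNl : forall a b c d, C a b c d = - C b a c d.
Hypothesis CNr : forall a b c d, C a b c d = - C a b d c.
Hypothesis Cbianchi : forall a b c d, C a b c d + C b c a d + C c a b d = 0.
Hypothesis Cpair : forall a b c d, C a b c d = C c d a b.
Hypothesis Ctrace : forall b d, ctr (fun a c => C a b c d) = 0.

(* C^{af}_{ex} Y_{yaft} *)
Definition hook_term x y e t : R :=
  ctr (fun c a => ctr (fun k f => C c k e x * Y (y :: a :: f :: t))).

(** After the trace, [Y] is skew in the indices paired with c and k, so only the part of [C c b e k]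
    skew in c and k counts; by the first Bianchi identity this is half of [C c k e b]. *)
Lemma ctr_block_term b d e t :
  2 * ctr (fun a c => block_term C c b a d e t) = - hook_term b d e t.
Proof.
have skT a f : Y (a :: d :: f :: t) = - Y (f :: d :: a :: t).
  by rewrite (skew_seq_swap a d _ skY) (skY [:: d] a f t)
             (skew_seq_swap d f _ skY) opprK.
rewrite mulr_natl mulr2n {1}/block_term.
rewrite [X in _ + X](ctr_skew_swap (fun c k => C c b e k) skT) -ctrN -ctrD.
rewrite /hook_term [in RHS]ctr_swap -ctrN; apply: eq_ctr => a c.
rewrite -!ctrN -ctrD; apply: eq_ctr => k f.
have -> : C c k e b = C c b e k - C k b e c.
  have := Cbianchi e k c b; rewrite (CNl k c) (CNl c e).
  by rewrite (Cpair c b e k) (Cpair k b e c); lra.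
by rewrite (skew_seq_swap a d _ skY); ring.
Qed.

(** Three indices of C are contracted with three skew indices of [Y]. A cyclic permutation of them
    does not change the value, while the three cyclic versions add up to zero by the first Bianchi
    identity. *)
Lemma ctr_hook_term e t : ctr (fun b d => hook_term b d e t) = 0.
Proof.
pose T d a f := Y (d :: a :: f :: t).
pose Z (B : 'I_n -> 'I_n -> 'I_n -> R) :=
  ctr (fun b d => ctr (fun c a => ctr (fun k f => B b c k * T d a f))).
have Tcyc d a f : T f d a = T d a f.
  by rewrite /T (skew_seq_swap f d _ skY) (skY [:: d] f a t) opprK.
have Zcyc (B : 'I_n -> 'I_n -> 'I_n -> R) : Z B = Z (fun b c k => B k b c).
  rewrite /Z ctr_exchange; apply: eq_ctr => c a.
  rewrite ctr_exchange; apply: eq_ctr => k f; apply: eq_ctr => b d.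
  by rewrite (Tcyc f d a) (Tcyc d a f).
pose B b c k := C c k e b.
have sumB b c k : B b c k + B k b c + B c k b = 0.
  have := Cbianchi c k b e; rewrite /B (CNr c k e b) (CNr b c e k) (CNr k b e c).
  lra.
have Z3 : Z B + Z (fun b c k => B k b c) + Z (fun b c k => B c k b) = 0.
  rewrite /Z -!ctrD -[RHS]ctr0; apply: eq_ctr => b d.
  rewrite -!ctrD -[RHS]ctr0; apply: eq_ctr => c a.
  rewrite -!ctrD -[RHS]ctr0; apply: eq_ctr => k f.
  by rewrite -!mulrDl sumB mul0r.
have Z1 : Z (fun b c k => B k b c) = Z B by rewrite [RHS]Zcyc.
have Z2 : Z (fun b c k => B c k b) = Z B by rewrite [RHS]Zcyc [RHS]Zcyc.
by move: Z3; rewrite Z1 Z2 -/(Z B); lra.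
Qed.

(** No head term survives: four are traces of C, and the other four form two pairs which, by pair
    symmetry, are symmetric in indices contracted with a skew pair of [Y]. *)
Lemma ctr_curv_op b d E :
  ctr (fun a c => curv_op C a c b d E) =
  altsum (fun e t => hook_term b d e t + hook_term d b e t) E.
Proof.
have skE a f : Y (a :: f :: E) = - Y (f :: a :: E) by exact: skew_seq_swap.
have sym0 (B : 'I_n -> 'I_n -> R) : (forall c k, B c k = B k c) ->
    ctr (fun a c => ctr (fun k f => B c k * Y (a :: f :: E))) = 0.
  move=> symB; have := ctr_skew_swap B skE.
  rewrite (_ : ctr (fun a c => ctr (fun k f => B k c * Y (a :: f :: E))) =
    ctr (fun a c => ctr (fun k f => B c k * Y (a :: f :: E)))); first by lra.
  by apply: eq_ctr => a c; apply: eq_ctr => k f; rewrite symB.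
have h1 : ctr (fun a c => head_term C b c d a E + head_term C d c b a E) = 0.
  rewrite -[RHS](sym0 (fun c k => C b c d k + C d c b k)).
    apply: eq_ctr => a c; rewrite -ctrD; apply: eq_ctr => k f.
    by rewrite mulrDl.
  by move=> c k; rewrite (Cpair b c d k) (Cpair b k d c) addrC.
have h3 x w : ctr (fun a c => head_term C a x c w E) = 0.
  rewrite ctr_exchange -[RHS]ctr0; apply: eq_ctr => k f.
  by rewrite ctrZr Ctrace mul0r.
have h2 := h1; rewrite ctr_swap ctrD in h2; rewrite ctrD in h1.
have h4 x w : ctr (fun a c => head_term C c x a w E) = 0.
  by rewrite ctr_swap h3.
rewrite /curv_op ctrB !ctrD -altsum_ctr h3 h3 h4 h4.
have -> : altsum (fun e t => ctr (fun a c =>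
      block_term C c b a d e t + block_term C a b c d e t
      + block_term C c d a b e t + block_term C a d c b e t)) E =
    - altsum (fun e t => hook_term b d e t + hook_term d b e t) E.
  rewrite -altsumN; apply: eq_altsum => e t _; rewrite !ctrD.
  rewrite (ctr_swap (fun a c => block_term C a b c d e t)).
  rewrite (ctr_swap (fun a c => block_term C a d c b e t)).
  have := ctr_block_term b d e t; have := ctr_block_term d b e t; lra.
move: h1 h2; lra.
Qed.

(* The double trace, over (a, c) and (b, d), forces S to be trace-free; the
   trace over (a, c) then determines S. *)
Lemma metric_op_unique (q : nat) (kappa : R) S : (q.+2 < n)%N ->
  kappa = 2 / q.+2%:R ->
  (forall x y s, S x y s = S y x s) ->
  (forall x y, skew_seq (S x y)) ->
  (forall a b c d E, size E = q ->
     curv_op C a c b d E + kappa * metric_op S a c b d E = 0) ->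
  forall x y E, size E = q ->
  S x y E = q.+2%:R / (2 * (n%:R - q.+2%:R)) *
    (2^-1 * (altsum (hook_term x y) E + altsum (hook_term y x) E)).
Proof.
move=> qn kE symS skS eqX.
have p0 : q.+2%:R != 0 :> R by rewrite pnatr_eq0.
have np : (n%:R : R) = q.+2%:R + (n - q.+2)%:R by rewrite -natrD subnKC // ltnW.
have d0 : (n - q.+2)%:R > 0 :> R by rewrite ltr0n subn_gt0.
have qE : (q.+2%:R : R) = q%:R + 2 by rewrite -addn2 natrD.
pose tau s := ctr (fun a c => S a c s).
have tr1 b d E : size E = q ->
    altsum (hook_term b d) E + altsum (hook_term d b) E +
    kappa * ((4 - 2 * n%:R + 2 * q%:R) * S b d E - 2 * (G b d * tau E)
      + altsum (fun e t => G b e * tau (d :: t) + G d e * tau (b :: t)) E) = 0.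
  move=> szE; rewrite -altsumD -ctr_curv_op -{1}szE -ctr_metric_op //.
  rewrite -ctrZ -ctrD -[RHS]ctr0; apply: eq_ctr => a c; exact: eqX.
have tau0 E : size E = q -> tau E = 0.
  move=> szE.
  have skt : skew_seq tau.
    move=> s1 x y s2; rewrite /tau -ctrN; apply: eq_ctr => a c; exact: skS.
  have : ctr (fun b d => altsum (hook_term b d) E + altsum (hook_term d b) E +
    kappa * ((4 - 2 * n%:R + 2 * q%:R) * S b d E - 2 * (G b d * tau E)
      + altsum (fun e t => G b e * tau (d :: t) + G d e * tau (b :: t)) E)) = 0.
    by rewrite -[RHS]ctr0; apply: eq_ctr => b d; exact: tr1.
  rewrite ctrD (ctrD (fun b d => altsum (hook_term b d) E)).
  rewrite (ctr_swap (fun b d => altsum (hook_term d b) E)) -altsum_ctr.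
  rewrite [altsum _ E](_ : _ = 0); last first.
    rewrite -[RHS](altsum0 _ E); apply: eq_altsum => e t _; exact: ctr_hook_term.
  rewrite addr0 add0r ctrZ ctrD ctrB !ctrZ -/(tau E) ctrZr ctr_dim -altsum_ctr.
  rewrite (_ : altsum _ E = 2 * q%:R * tau E); last first.
    rewrite -mulrA -szE -altsum_skew // -altsumZ; apply: eq_altsum => e t _.
    rewrite ctrD; under eq_ctr do rewrite symG.
    rewrite ctr_metric; under eq_ctr do rewrite symG mulrC.
    by rewrite ctr_metricr; ring.
  move/eqP; rewrite mulf_eq0 kE mulf_eq0 invr_eq0 (negPf p0) pnatr_eq0 /=.
  rewrite np qE => /eqP.
  set m := (n - q.+2)%:R in d0 *.
  move=> H.
  (* The coefficient of the double trace is 4 - 4n + 4q; with p = q + 2 and m = n - p it equals -4(m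
     + 1). *)
  have : (m + 1) * tau E = 0 by move: H; lra.
  by move/eqP; rewrite mulf_eq0 => /orP[/eqP ? | /eqP //]; lra.
move=> x y E szE; have := tr1 x y E szE.
rewrite tau0 // (_ : altsum (fun e t => _ + _) E = 0); last first.
  rewrite -[RHS](altsum0 _ E); apply: eq_altsum => e t szt.
  by rewrite !tau0 ?mulr0 ?addr0 //= szt.
rewrite np kE qE; set m := (n - q.+2)%:R in d0 *.
have q20 : (q%:R + 2 : R) != 0 by rewrite -qE.
move=> H.
(* With tau gone, S keeps the coefficient 4 - 2n + 2q = -2m, and m > 0 permits the division. *)
have -> : altsum (hook_term x y) E + altsum (hook_term y x) E =
    4 * m / (q%:R + 2) * S x y E.
  by move/eqP: H; rewrite addr_eq0 => /eqP ->; field.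
by field; rewrite q20 addrAC subrr add0r gt_eqF.
Qed.

End TraceFree.

(** * Second derivatives of a CKY form *)

Section Prolongation.
Variables (K : 'I_n -> 'I_n -> 'I_n -> 'I_n -> R) (kappa : R).
Variables (D2 : 'I_n -> 'I_n -> seq 'I_n -> R) (H : 'I_n -> seq 'I_n -> R).
Hypothesis KNl : forall a b c d, K a b c d = - K b a c d.
Hypothesis skH : forall a, skew_seq (H a).
Hypothesis skD2 : forall c a, skew_seq (D2 c a).
Hypothesis D2_CKY : forall c a b s, D2 c a (b :: s) + D2 c b (a :: s) =
  kappa * (altsum (fun x t => G a x * H c t) (b :: s)
           + altsum (fun x t => G b x * H c t) (a :: s)).
Hypothesis D2_comm : forall c a s, D2 c a s - D2 a c s =
  slot_sum (fun f e => \sum_k Gi f k * K c a e k) Y s.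

Lemma ctr_contract (A T : 'I_n -> R) :
  \sum_f (\sum_k Gi f k * A k) * T f = ctr (fun k f => A k * T f).
Proof.
rewrite /ctr exchange_big; apply: eq_bigr => f _; rewrite mulr_suml.
by apply: eq_bigr => k _; rewrite symGi mulrA.
Qed.

Lemma slot_sum_curv c a b d E :
  slot_sum (fun f e => \sum_k Gi f k * K c a e k) Y (b :: d :: E) =
  head_term K c a d b E - head_term K c a b d E
  + altsum (block_term K c a b d) E.
Proof.
rewrite !slot_sum_cons slot_sum_altsum; last exact: (skew_seq_cons d (skew_seq_cons b skY)).
rewrite addrA; congr (_ + _); last first.
  by apply: eq_altsum => e t _; rewrite ctr_contract.
rewrite !ctr_contract addrC; congr (_ + _).
by rewrite -ctrN; apply: eq_ctr => k f; rewrite (skew_seq_swap f d) // mulrN.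
Qed.

(* D2 c a (b ...) is determined by its symmetric part in (a, b) and its
   antisymmetric part in (c, a); the identity expresses that the resulting
   formula is skew in (b, d). *)
Lemma prolongation_identity a c b d E :
  curv_op K a c b d E
  + kappa * metric_op (fun x y s => H x (y :: s) + H y (x :: s)) a c b d E = 0.
Proof.
pose gam x y z w := altsum (fun e t => G x e * H y (z :: w :: t)) E.
have gamN x y z w : gam x y z w = - gam x y w z.
  rewrite -altsumN; apply: eq_altsum => e t _.
  by rewrite skew_seq_swap // mulrN.
pose g x y z w := 2 * G y z * H x (w :: E) - G y w * H x (z :: E)
  - G z w * H x (y :: E) + gam y x z w + gam z x y w.
pose Q x y z w := head_term K x y w z E - head_term K x y z w E
  + altsum (block_term K x y z w) E.
pose N x y z w := D2 x y (z :: w :: E).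
have NN x y z w : N x y z w = - N x y w z by exact: skew_seq_swap.
have Ng x y z w : N x y z w + N x z y w = kappa * g x y z w.
  rewrite /N D2_CKY /= !opprB !addrA; congr (_ * _).
  by rewrite /g /gam (symG z y); ring.
have NQ x y z w : N x y z w - N y x z w = Q x y z w.
  by rewrite /N D2_comm slot_sum_curv.
(* The Koszul combination: three symmetric-part equations and three commutators, with signs that
   leave only [N c a z w]. *)
have twoN z w : 2 * N c a z w =
    kappa * (g c a z w - g z c a w + g a z c w)
    - Q c z a w + Q z a c w - Q a c z w.
  have := Ng c a z w; have := NQ c z a w; have := Ng z c a w.
  have := NQ z a c w; have := Ng a z c w; have := NQ a c z w; lra.
(* Skewness of [N c a] in b and d makes the two solved expressions add up to zero. *)
have : kappa * (g c a b d - g b c a d + g a b c d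
                + (g c a d b - g d c a b + g a d c b))
    + (- Q c b a d + Q b a c d - Q a c b d
       + (- Q c d a b + Q d a c b - Q a c d b)) = 0.
  by have := twoN b d; have := twoN d b; have := NN c a b d; lra.
suff [-> ->] :
    (- Q c b a d + Q b a c d - Q a c b d
       + (- Q c d a b + Q d a c b - Q a c d b) = curv_op K a c b d E) /\
    (g c a b d - g b c a d + g a b c d
       + (g c a d b - g d c a b + g a d c b) =
     metric_op (fun x y s => H x (y :: s) + H y (x :: s)) a c b d E).
  by rewrite addrC.
split.
  have hN x y z w : head_term K x y z w E = - head_term K y x z w E.
    by rewrite -ctrN; apply: eq_ctr => k f; rewrite KNl mulNr.
  have bN x y z w : altsum (block_term K x y z w) E =
      - altsum (block_term K y x z w) E.
    rewrite -altsumN; apply: eq_altsum => e t _.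
    by rewrite -ctrN; apply: eq_ctr => k f; rewrite KNl mulNr.
  have bNr x y z w : altsum (block_term K x y z w) E =
      - altsum (block_term K x y w z) E.
    rewrite -altsumN; apply: eq_altsum => e t _.
    by rewrite -ctrN; apply: eq_ctr => k f; rewrite skew_seq_swap // mulrN.
  rewrite /curv_op !altsumD /Q.
  have := hN b a c d; have := hN d a c b; have := hN c b d a.
  have := hN c d b a; have := bN b a c d; have := bN d a c b.
  have := bNr a c b d; lra.
have gamS x y z w :
    altsum (fun e t => G x e * (H y (z :: w :: t) + H z (y :: w :: t))) E =
    gam x y z w + gam x z y w.
  by rewrite -altsumD; apply: eq_altsum => e t _; rewrite mulrDr.
rewrite /metric_op !altsumD !gamS /g.
rewrite (gamN a c b d) (gamN c a b d) (gamN c b a d) (gamN a b c d).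
rewrite (gamN c d a b) (gamN a d c b).
rewrite ?(symG d c) ?(symG b a) ?(symG d a) ?(symG d b) ?(symG c b) ?(symG c a).
ring.
Qed.

End Prolongation.

End CurvatureAction.
End MetricContraction.

(** * Partial derivatives and the Levi-Civita connection *)

Section PartialDerivatives.
Local Open Scope classical_set_scope.
Variables (R : realType) (n : nat).
Implicit Types (f g : 'rV[R]_n -> R) (u v x : 'rV[R]_n) (U : set 'rV[R]_n).

Definition pderivable (k : 'I_n) f u : Prop :=
  derivable (f : 'rV[R]_n -> R^o) u (delta_mx 0 k).

Lemma partialD k f g u : pderivable k f u -> pderivable k g u ->
  partial k (fun v => f v + g v) u = partial k f u + partial k g u.
Proof. by move=> df dg; exact: (deriveD df dg). Qed.

Lemma pderivableD k f g u : pderivable k f u -> pderivable k g u ->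
  pderivable k (fun v => f v + g v) u.
Proof. by move=> df dg; exact: (derivableD df dg). Qed.

Lemma partialN k f u : pderivable k f u ->
  partial k (fun v => - f v) u = - partial k f u.
Proof. by move=> df; exact: (deriveN df). Qed.

Lemma partialB k f g u : pderivable k f u -> pderivable k g u ->
  partial k (fun v => f v - g v) u = partial k f u - partial k g u.
Proof. by move=> df dg; exact: (deriveB df dg). Qed.

Lemma pderivableB k f g u : pderivable k f u -> pderivable k g u ->
  pderivable k (fun v => f v - g v) u.
Proof. by move=> df dg; exact: (derivableB df dg). Qed.

Lemma partialM k f g u : pderivable k f u -> pderivable k g u ->
  partial k (fun v => f v * g v) u = partial k f u * g u + f u * partial k g u.
Proof.
move=> df dg; rewrite addrC [X in _ + X]mulrC.
exact: (@deriveM _ _ f g u (delta_mx 0 k) df dg).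
Qed.

Lemma pderivableM k f g u : pderivable k f u -> pderivable k g u ->
  pderivable k (fun v => f v * g v) u.
Proof.
move=> df dg; exact: (@derivableM _ _ f g u (delta_mx 0 k) df dg).
Qed.

Lemma pderivableV k f u : f u != 0 -> pderivable k f u ->
  pderivable k (fun v => (f v)^-1) u.
Proof.
move=> f0 df; exact: (@derivableV _ _ f u (delta_mx 0 k) f0 df).
Qed.

Lemma partial_cst k (c : R) u : partial k (fun=> c) u = 0.
Proof. exact: (@derive_cst _ _ R^o c u). Qed.

Lemma pderivable_cst k (c : R) u : pderivable k (fun=> c) u.
Proof. exact: (@derivable_cst _ _ R^o c u). Qed.

Lemma partial_sumP (I : Type) (r : seq I) k (F : I -> 'rV[R]_n -> R) u :
  (forall j, pderivable k (F j) u) ->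
  pderivable k (fun v => \sum_(j <- r) F j v) u /\
  partial k (fun v => \sum_(j <- r) F j v) u = \sum_(j <- r) partial k (F j) u.
Proof.
move=> dF; elim: r => [|j r [IHd IH]].
  rewrite (_ : (fun v => _) = fun=> 0); last first.
    by apply/funext => v; rewrite big_nil.
  by split; [exact: pderivable_cst | rewrite partial_cst big_nil].
rewrite (_ : (fun v => _) = fun v => F j v + \sum_(j <- r) F j v); last first.
  by apply/funext => v; rewrite big_cons.
split; first exact: (pderivableD (dF j) IHd).
by rewrite (partialD (dF j) IHd) big_cons IH.
Qed.

Lemma pderivable_sum (I : Type) (r : seq I) k (F : I -> 'rV[R]_n -> R) u :
  (forall j, pderivable k (F j) u) ->
  pderivable k (fun v => \sum_(j <- r) F j v) u.
Proof. by move=> dF; have [] := partial_sumP r dF. Qed.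

Lemma partial_sum (I : Type) (r : seq I) k (F : I -> 'rV[R]_n -> R) u :
  (forall j, pderivable k (F j) u) ->
  partial k (fun v => \sum_(j <- r) F j v) u = \sum_(j <- r) partial k (F j) u.
Proof. by move=> dF; have [] := partial_sumP r dF. Qed.

Lemma pderivable_prod (I : Type) (r : seq I) k (F : I -> 'rV[R]_n -> R) u :
  (forall j, pderivable k (F j) u) ->
  pderivable k (fun v => \prod_(j <- r) F j v) u.
Proof.
move=> dF; elim: r => [|j r IH].
  rewrite (_ : (fun v => _) = fun=> 1); first exact: pderivable_cst.
  by apply/funext => v; rewrite big_nil.
rewrite (_ : (fun v => _) = fun v => F j v * \prod_(j <- r) F j v).
  exact: (pderivableM (dF j) IH).
by apply/funext => v; rewrite big_cons.
Qed.

Lemma near_eq_open U u f g : open U -> U u -> (forall v, U v -> f v = g v) ->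
  {near u, f =1 g}.
Proof.
move=> oU Uu fg; apply: filterS (open_nbhs_nbhs (conj oU Uu)) => v Uv.
exact: fg.
Qed.

Lemma eq_partial U u k f g : open U -> U u -> (forall v, U v -> f v = g v) ->
  partial k f u = partial k g u.
Proof.
move=> oU Uu fg; exact: (@near_eq_derive _ _ R^o _ _ _ _ (near_eq_open oU Uu fg)).
Qed.

Lemma eq_pderivable U u k f g : open U -> U u -> (forall v, U v -> f v = g v) ->
  pderivable k f u -> pderivable k g u.
Proof.
move=> oU Uu fg; exact: (near_eq_derivable (near_eq_open oU Uu fg)).
Qed.

(** The difference quotients of t -> f(x + t v) are literally those of f along v, so the
    one-variable mean value theorem applies. *)
Lemma MVT_line f x v (s : R) : 0 < s ->
  (forall t, 0 <= t <= s ->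
     derivable (f : 'rV[R]_n -> R^o) (x + t *: v) v) ->
  exists2 c, 0 < c < s &
    f (x + s *: v) - f x = 'D_v (f : 'rV[R]_n -> R^o) (x + c *: v) * s.
Proof.
move=> s0 df; pose g (t : R) : R^o := f (x + t *: v).
have eqg t : (fun h : R => h^-1 *: (g (h *: 1 + t) - g t)) =
   (fun h : R => h^-1 *: ((f (h *: v + (x + t *: v)) : R^o) - f (x + t *: v))).
  apply/funext => h; rewrite /g; congr (_ *: (f _ - _)).
  by rewrite scalerDl addrCA -scalerA scale1r.
have dg t : 0 <= t <= s ->
    is_derive t (1 : R) g ('D_v (f : 'rV[R]_n -> R^o) (x + t *: v)).
  move=> ts; apply: DeriveDef; first by rewrite /derivable eqg; exact: df.
  by rewrite /derive eqg.
have gc : {within `[0, s], continuous g}.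
  apply: derivable_within_continuous => t; rewrite in_itv => ts.
  by have [] := dg t ts.
have dg' t : t \in `]0, s[%R ->
    is_derive t (1 : R) g ('D_v (f : 'rV[R]_n -> R^o) (x + t *: v)).
  by rewrite in_itv /= => /andP[t0 ts]; apply: dg; rewrite !ltW.
have [c] := MVT s0 dg' gc; rewrite in_itv /= => cs.
by rewrite /g scale0r addr0 subr0 => e; exists c.
Qed.

Lemma derivable_translate f y x v :
  derivable (f : 'rV[R]_n -> R^o) (x + y) v ->
  derivable ((fun z => f (z + y)) : 'rV[R]_n -> R^o) x v.
Proof.
rewrite /derivable.
rewrite (_ : (fun h : R => h^-1 *: ((f (h *: v + (x + y)) : R^o) - f (x + y))) =
  (fun h : R => h^-1 *: ((f ((h *: v + x) + y) : R^o) - f (x + y)))) //.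
by apply/funext => h; rewrite addrA.
Qed.

Lemma derive_translate f y x v :
  'D_v ((fun z => f (z + y)) : 'rV[R]_n -> R^o) x =
  'D_v (f : 'rV[R]_n -> R^o) (x + y).
Proof.
rewrite /derive.
rewrite (_ : (fun h : R => h^-1 *: ((f (h *: v + (x + y)) : R^o) - f (x + y))) =
  (fun h : R => h^-1 *: ((f ((h *: v + x) + y) : R^o) - f (x + y)))) //.
by apply/funext => h; rewrite addrA.
Qed.

Lemma partial_translate k f y x :
  partial k (fun z => f (z + y)) x = partial k f (x + y).
Proof. exact: derive_translate. Qed.

Local Opaque partial.

Let e_ (a : 'I_n) : 'rV[R]_n := delta_mx 0 a.

(** The mean value theorem is used twice: along a for the increment of f in direction b, then along
    b for the a-derivative of f. *)
Lemma second_difference f u a b (s : R) : 0 < s ->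
  (forall r t, 0 <= r <= s -> 0 <= t <= s ->
     pderivable a f (u + r *: e_ a + t *: e_ b) /\
     pderivable b (partial a f) (u + r *: e_ a + t *: e_ b)) ->
  exists r t, [/\ 0 < r < s, 0 < t < s &
    f (u + s *: e_ a + s *: e_ b) - f (u + s *: e_ a)
      - (f (u + s *: e_ b) - f u) =
    partial b (partial a f) (u + r *: e_ a + t *: e_ b) * s * s].
Proof.
move=> s0 df.
have s01 : 0 <= s <= s by rewrite lexx ltW.
have s00 : 0 <= (0 : R) <= s by rewrite lexx ltW.
pose phi x := f (x + s *: e_ b) - f x.
have d1 r : 0 <= r <= s -> pderivable a (fun z => f (z + s *: e_ b)) (u + r *: e_ a).
  move=> rs; have [h _] := df r s rs s01.
  exact: (@derivable_translate f (s *: e_ b) (u + r *: e_ a) (e_ a) h).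
have d2 r : 0 <= r <= s -> pderivable a f (u + r *: e_ a).
  by move=> rs; have [] := df r 0 rs s00; rewrite scale0r addr0.
have [|r rs e1] := @MVT_line phi u (e_ a) s s0.
  by move=> t ts; apply: pderivableB; [exact: d1 | exact: d2].
have rs' : 0 <= r <= s by have /andP[r0 r1] := rs; rewrite !ltW.
have [|t ts e2] := @MVT_line (partial a f) (u + r *: e_ a) (e_ b) s s0.
  by move=> t ts; have [] := df r t rs' ts.
exists r, t; split=> //; move: e1; rewrite /phi => ->.
congr (_ * _); rewrite -[RHS]e2 -[LHS]/(partial a phi (u + r *: e_ a)).
rewrite partialB; [|exact: d1|exact: d2].
by rewrite partial_translate.
Qed.

(** Schwarz's theorem. If the two values differed, continuity would keep the mixed partials apart
    near u, whereas one second difference equals both of them, at nearby points, up to the same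
    factor. *)
Lemma partial_comm U f u a b : open U -> U u -> Cn 2 U f ->
  partial a (partial b f) u = partial b (partial a f) u.
Proof.
move=> oU Uu [_ C2f].
have dU c d v : U v -> pderivable c f v /\ pderivable d (partial c f) v.
  by move=> Uv; have [fd [_ /(_ d) [pd _]]] := C2f c; split; [exact: fd | exact: pd].
have ct c d : {for u, continuous (partial d (partial c f))}.
  by have [_ [_ /(_ d) [_ [cd _]]]] := C2f c; exact: cd.
apply/eqP/negP => /negP ne.
set L1 := partial a (partial b f) u in ne *; set L2 := partial b (partial a f) u in ne *.
have e0 : 0 < `|L1 - L2| / 2 by rewrite divr_gt0 // normr_gt0 subr_eq0.
have near1 : \forall v \near u, `|L1 - partial a (partial b f) v| < `|L1 - L2| / 2.
  by have /cvgrPdist_lt := ct b a; apply.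
have near2 : \forall v \near u, `|L2 - partial b (partial a f) v| < `|L1 - L2| / 2.
  by have /cvgrPdist_lt := ct a b; apply.
have nearU : \forall v \near u, U v by apply: open_nbhs_nbhs.
have : \forall v \near u, [/\ U v,
    `|L1 - partial a (partial b f) v| < `|L1 - L2| / 2 &
    `|L2 - partial b (partial a f) v| < `|L1 - L2| / 2].
  apply: filterS3 nearU near1 near2 => v; exact: And3.
move=> /nbhs_ballP[d /= d0 bd].
(* Both offsets may fall on the same coordinate; their sum is then at most d / 2, still inside the
   ball. *)
pose s := d / 4.
have s0 : 0 < s by rewrite divr_gt0.
have sq r t c c' : 0 <= r <= s -> 0 <= t <= s -> ball u d (u + r *: e_ c + t *: e_ c').
  move=> /andP[r0 rs] /andP[t0 ts]; split=> // i j; rewrite /ball /= !mxE.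
  rewrite ltr_norml; apply/andP.
  by case: (_ && _); case: (_ && _); rewrite /= ?mulr1 ?mulr0; split;
    rewrite /s in rs ts; lra.
have dsq c c' r t : 0 <= r <= s -> 0 <= t <= s ->
     pderivable c f (u + r *: e_ c + t *: e_ c') /\
     pderivable c' (partial c f) (u + r *: e_ c + t *: e_ c').
  by move=> rs ts; apply: dU; have [] := bd _ (sq r t c c' rs ts).
have [r1 [t1 [r1s t1s e1]]] := second_difference s0 (@dsq a b).
have [r2 [t2 [r2s t2s e2]]] := second_difference s0 (@dsq b a).
have wk r : 0 < r < s -> 0 <= r <= s by move=> /andP[? ?]; rewrite !ltW.
have [_ _ h2] := bd _ (sq r1 t1 a b (wk _ r1s) (wk _ t1s)).
have [_ h1 _] := bd _ (sq r2 t2 b a (wk _ r2s) (wk _ t2s)).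
have sn0 : s != 0 by rewrite gt_eqF.
move: h1 h2 e1 e2; rewrite (addrAC u (s *: e_ b) (s *: e_ a)).
move: (partial a (partial b f) _) (partial b (partial a f) _) => m m'.
move: (f (u + s *: e_ a + s *: e_ b)) (f (u + s *: e_ a)) (f (u + s *: e_ b)) (f u).
move=> w x y z h1 h2 e1 e2.
(* The second difference is symmetric in a and b, so both mean value points give the same number. *)
have e : m' = m by do 2!apply: (mulIf sn0); rewrite -e1 -e2; ring.
rewrite e in h2 => {e e1 e2}; clearbody L1 L2.
have := ler_normD (L1 - m) (m - L2); rewrite addrA subrK (distrC m); lra.
Qed.

End PartialDerivatives.

Section PartialTensor.
Local Open Scope classical_set_scope.
Local Opaque partial pderivable.
Variables (R : realType) (n : nat).
Implicit Types (u : 'rV[R]_n) (k : 'I_n) (E : seq 'I_n).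

Lemma partial_slot_sumP k (A : 'rV[R]_n -> 'I_n -> 'I_n -> R)
    (T : 'rV[R]_n -> seq 'I_n -> R) u E :
  (forall f e, pderivable k (fun v => A v f e) u) ->
  (forall s, pderivable k (fun v => T v s) u) ->
  pderivable k (fun v => slot_sum (A v) (T v) E) u /\
  partial k (fun v => slot_sum (A v) (T v) E) u =
  slot_sum (fun f e => partial k (fun v => A v f e) u) (T u) E
  + slot_sum (A u) (fun s => partial k (fun v => T v s) u) E.
Proof.
move=> dA dT; split.
  do 2!apply: pderivable_sum => ?; exact: pderivableM.
rewrite /slot_sum -big_split partial_sum.
  apply: eq_bigr => j _; rewrite partial_sum -?big_split.
    by apply: eq_bigr => f _; rewrite partialM.
  by move=> f; exact: pderivableM.
by move=> j; apply: pderivable_sum => f; exact: pderivableM.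
Qed.

Lemma partial_altsumP k (P : 'rV[R]_n -> 'I_n -> seq 'I_n -> R) u E :
  (forall x t, pderivable k (fun v => P v x t) u) ->
  pderivable k (fun v => altsum (P v) E) u /\
  partial k (fun v => altsum (P v) E) u =
  altsum (fun x t => partial k (fun v => P v x t) u) E.
Proof.
elim: E P => [|x E IH] P dP /=.
  by split; [exact: pderivable_cst | exact: partial_cst].
have [d e] := IH (fun v y t => P v y (x :: t)) (fun y t => dP y (x :: t)).
split; first exact: (pderivableB (dP x E) d).
by rewrite (partialB (dP x E) d) e.
Qed.

Lemma pderivable_det m (A : 'rV[R]_n -> 'M[R]_m) k u :
  (forall a b, pderivable k (fun v => A v a b) u) ->
  pderivable k (fun v => \det (A v)) u.
Proof.
move=> dA; apply: pderivable_sum => s; apply: pderivableM.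
  exact: pderivable_cst.
exact: pderivable_prod.
Qed.

Lemma Cn_cst m (U : set 'rV[R]_n) (c : R) : Cn m U (fun=> c).
Proof.
elim: m c => [|m IH] c /=; split=> //; try by move=> u _; exact: cst_continuous.
move=> k; split; first by move=> u _; exact: pderivable_cst.
rewrite (_ : partial k _ = fun=> 0); first exact: IH.
by apply/funext => u; rewrite partial_cst.
Qed.

End PartialTensor.

(** * The Levi-Civita connection and its curvature in one chart *)

Section ChartCalculus.
Local Open Scope classical_set_scope.
Local Opaque partial pderivable.
Variables (R : realType) (n : nat) (U : set 'rV[R]_n) (G : 'rV[R]_n -> 'M[R]_n).
Hypothesis openU : open U.
Hypothesis symG : forall v, U v -> forall a b, G v a b = G v b a.
Hypothesis C2G : forall a b, Cn 2 U (fun v => G v a b).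
Hypothesis Gunit : forall v, U v -> G v \in unitmx.
Implicit Types (u v : 'rV[R]_n) (T : 'rV[R]_n -> seq 'I_n -> R).

Lemma Cn2_pderivable f k u : Cn 2 U f -> U u -> pderivable k f u.
Proof. by move=> [_ /(_ k) [df _]] /df. Qed.

Lemma Cn2_pderivable_partial f k l u :
  Cn 2 U f -> U u -> pderivable l (partial k f) u.
Proof. by move=> [_ /(_ k) [_ [_ /(_ l) [df _]]]] /df. Qed.

Lemma ginvK v : U v -> forall a b,
  \sum_k ginv G v a k * G v k b = (a == b)%:R.
Proof.
move=> Uv a b; have := mulVmx (Gunit Uv) => /matrixP /(_ a b).
by rewrite !mxE.
Qed.

Lemma ginv_sym v : U v -> forall a b, ginv G v a b = ginv G v b a.
Proof.
move=> Uv a b; rewrite /ginv.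
have sG : (G v)^T = G v by apply/matrixP => c d; rewrite mxE symG.
by rewrite -[in LHS]sG -trmx_inv mxE.
Qed.

(** Cramer's rule: an entry of the inverse is a cofactor over the determinant, both polynomial in
    the entries of [G]. *)
Lemma pderivable_ginv u k a b : U u -> pderivable k (fun v => ginv G v a b) u.
Proof.
move=> Uu; pose adj v := (\det (G v))^-1 * (\adj (G v)) a b.
apply: (@eq_pderivable _ _ U u k adj) => // [v Uv|].
  by rewrite /ginv /invmx Gunit // mxE.
apply: pderivableM.
  apply: pderivableV; first by rewrite -unitfE -unitmxE Gunit.
  by apply: pderivable_det => c d; exact: Cn2_pderivable.
rewrite (_ : (fun v => _) = fun v =>
    (-1) ^+ (b + a) * \det (row' b (col' a (G v)))); last first.
  by apply/funext => v; rewrite mxE.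
apply: pderivableM; first exact: pderivable_cst.
apply: pderivable_det => c d.
rewrite (_ : (fun v => _) = fun v => G v (lift b c) (lift a d)); last first.
  by apply/funext => v; rewrite !mxE.
exact: Cn2_pderivable.
Qed.

Let Gam u (c f e : 'I_n) := christoffel G u f c e.

Lemma pderivable_christoffel u k f a b : U u ->
  pderivable k (fun v => christoffel G v f a b) u.
Proof.
move=> Uu; apply: pderivableM; first exact: pderivable_cst.
apply: pderivable_sum => l; apply: pderivableM; first exact: pderivable_ginv.
apply: pderivableB; last exact: Cn2_pderivable_partial.
by apply: pderivableD; exact: Cn2_pderivable_partial.
Qed.

Lemma christoffel_sym v : U v -> forall f a b,
  christoffel G v f a b = christoffel G v f b a.
Proof.
move=> Uv f a b; congr (_ * _); apply: eq_bigr => l _; congr (_ * _).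
rewrite [X in _ - X](@eq_partial _ _ U v l _ (fun w => G w b a)) //; last first.
  by move=> w Uw; exact: symG.
by rewrite [X in X - _]addrC.
Qed.

(** This is nabla g = 0. Lowering the upper index yields the Christoffel symbols of the first kind,
    and in the sum of two of them all but one derivative of g cancel. *)
Lemma metric_compat u c a b : U u ->
  partial c (fun v => G v a b) u =
  \sum_f christoffel G u f c a * G u f b + \sum_f christoffel G u f c b * G u a f.
Proof.
move=> Uu.
have low x y z : \sum_f christoffel G u f x y * G u f z =
    2^-1 * (partial x (fun v => G v z y) u + partial y (fun v => G v z x) u
            - partial z (fun v => G v x y) u).
  rewrite /christoffel; under eq_bigr do rewrite -mulrA mulr_suml.
  rewrite -mulr_sumr exchange_big (bigD1 z) //= [X in _ + X]big1 => [|l /negPf nl].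
    under eq_bigr do rewrite (ginv_sym Uu) mulrAC.
    by rewrite -mulr_suml ginvK // eqxx mul1r addr0.
  under eq_bigr do rewrite (ginv_sym Uu) mulrAC.
  by rewrite -mulr_suml ginvK // nl mul0r.
under [X in _ + X]eq_bigr do rewrite (symG Uu).
rewrite !low.
have sw x y z : partial x (fun v => G v y z) u = partial x (fun v => G v z y) u.
  by apply: (eq_partial _ openU Uu) => w Uw; exact: symG.
rewrite (sw a b c) (sw b a c) (sw c b a).
set X := partial c _ u; set X1 := partial a _ u; set X2 := partial b _ u.
by clearbody X X1 X2; field.
Qed.

Local Opaque christoffel.

Lemma pderivable_nabla T u k a s : U u -> (forall s, Cn 2 U (T ^~ s)) ->
  pderivable k (fun v => nabla G T v (a :: s)) u.
Proof.
move=> Uu C2T; apply: pderivableB; first exact: Cn2_pderivable_partial.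
apply: (proj1 (partial_slot_sumP _ _ _)) => [f e|t].
  exact: pderivable_christoffel.
exact: Cn2_pderivable.
Qed.

Lemma nabla_nabla T u c a s : U u -> (forall s, Cn 2 U (T ^~ s)) ->
  nabla G (nabla G T) u [:: c, a & s] =
  partial c (partial a (T ^~ s)) u
  - slot_sum (fun f e => partial c (fun v => Gam v a f e) u) (T u) s
  - slot_sum (Gam u a) (fun t => partial c (T ^~ t) u) s
  - (\sum_f Gam u c f a * nabla G T u (f :: s)
     + (slot_sum (Gam u c) (fun t => partial a (T ^~ t) u) s
        - slot_sum (Gam u c) (slot_sum (Gam u a) (T u)) s)).
Proof.
move=> Uu C2T; rewrite {1}/nabla slot_sum_cons; congr (_ - (_ + _)).
  have [||d e] := @partial_slot_sumP _ _ c (fun v => Gam v a) T u s.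
  - by move=> f e; exact: pderivable_christoffel.
  - by move=> t; exact: Cn2_pderivable.
  have d1 : pderivable c (partial a (T ^~ s)) u.
    exact: (Cn2_pderivable_partial (C2T s) Uu).
  by rewrite (partialB d1 d) e opprD addrA.
exact: slot_sumBr.
Qed.

(** R_{cae}^f in terms of Christoffel symbols, with f and e last so that it can act through
    [slot_sum]. *)
Definition curvature u c a f e : R :=
  partial a (fun v => Gam v c f e) u - partial c (fun v => Gam v a f e) u
  + \sum_k (Gam u c k e * Gam u a f k - Gam u a k e * Gam u c f k).

Lemma nabla_comm_curvature T u c a s : U u -> (forall s, Cn 2 U (T ^~ s)) ->
  nabla G (nabla G T) u [:: c, a & s] - nabla G (nabla G T) u [:: a, c & s] =
  slot_sum (curvature u c a) (T u) s.
Proof.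
move=> Uu C2T; rewrite !nabla_nabla //.
rewrite (partial_comm c a openU Uu (C2T s)).
rewrite (_ : \sum_f Gam u c f a * _ = \sum_f Gam u a f c * nabla G T u (f :: s));
  last by apply: eq_bigr => f _; rewrite /Gam christoffel_sym.
rewrite /curvature slot_sumDl slot_sumBl -slot_sum_commutator.
have cancel (x0 x1 x2 x3 x4 x1' x4' y : R) :
    x0 - x1 - x2 - (y + (x3 - x4)) - (x0 - x1' - x3 - (y + (x2 - x4'))) =
    x1' - x1 + (x4 - x4') by ring.
exact: cancel.
Qed.

Lemma riemannE u c a e f : U u -> riemann G u c a e f = curvature u c a f e.
Proof.
move=> Uu; rewrite /riemann nabla_comm_curvature //; last first.
  by move=> s; exact: Cn_cst.
rewrite slot_sum_cons slot_sum_nil addr0 (bigD1 f) //= big1 => [|k /negPf nk].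
  by rewrite /dx eqxx mulr1 addr0.
by rewrite /dx eqseq_cons nk mulr0.
Qed.

(** With no torsion, the derivative and quadratic parts are symmetric in the lower indices of the
    Christoffel symbols, and the cyclic sum cancels in pairs. *)
Lemma riemann_bianchi u a b c f : U u ->
  riemann G u a b c f + riemann G u b c a f + riemann G u c a b f = 0.
Proof.
move=> Uu; rewrite !riemannE //.
pose D x y z := partial x (fun v => Gam v y f z) u.
pose Q x y z := \sum_k Gam u x k y * Gam u z f k.
have Dsym x y z : D x y z = D x z y.
  by apply: (eq_partial _ openU Uu) => w Uw; exact: christoffel_sym.
have Qsym x y z : Q x y z = Q y x z.
  by apply: eq_bigr => k _; rewrite /Gam christoffel_sym.
have curvE x y z : curvature u x y f z = D y x z - D x y z + (Q x z y - Q y z x).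
  by rewrite /curvature sumrB.
rewrite !curvE; clearbody D Q.
rewrite (Dsym b c a) (Dsym a c b) (Dsym c b a) (Qsym c a) (Qsym b a) (Qsym c b).
ring.
Qed.

Lemma riemann_low_bianchi u a b c d : U u ->
  riemann_low G u a b c d + riemann_low G u b c a d + riemann_low G u c a b d = 0.
Proof.
move=> Uu; rewrite /riemann_low -!big_split big1 // => f _ /=.
by rewrite -!mulrDl riemann_bianchi ?mul0r.
Qed.

Lemma riemann_low_skewl u a b c d :
  riemann_low G u a b c d = - riemann_low G u b a c d.
Proof.
rewrite /riemann_low -sumrN; apply: eq_bigr => f _.
by rewrite -mulNr opprB.
Qed.

(** The metric is parallel, so the commutator of covariant derivatives kills it; applied to its two
    slots this commutator is R_{abcd} + R_{abdc}. *)
Lemma riemann_low_skewr u a b c d : U u ->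
  riemann_low G u a b c d = - riemann_low G u a b d c.
Proof.
move=> Uu; pose T v s := if s is [:: x; y] then G v x y else 0.
have C2T s : Cn 2 U (T ^~ s).
  move: s => [|x [|y [|z s]]]; try exact: Cn_cst.
  exact: C2G.
have dT v x s : U v -> nabla G T v (x :: s) = 0.
  move=> Uv; move: s => [|y [|z [|w s]]] /=.
  - by rewrite slot_sum_nil partial_cst subr0.
  - rewrite slot_sum_cons slot_sum_nil partial_cst big1 ?addr0 ?subr0 // => f _.
    by rewrite mulr0.
  - rewrite !slot_sum_cons slot_sum_nil addr0 /= metric_compat //.
    by rewrite subrr.
  - rewrite partial_cst sub0r -[RHS]oppr0; congr (- _).
    (* Slots preserve length, so only zero values occur here; zero is written [0 * 0] to let
       [slot_sumZr] extract a zero factor. *)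
    rewrite (eq_slot_sum (A' := fun f b => christoffel G v f x b)
      (T' := fun s => 0 * 0)) //; first by rewrite slot_sumZr mul0r.
    by move=> [|? [|? [|? ?]]] //= _; rewrite mul0r.
have ddT x y s : nabla G (nabla G T) u [:: x, y & s] = 0.
  rewrite {1}/nabla (@eq_partial _ _ U u x _ (fun=> 0)) //; last first.
    by move=> v Uv; exact: dT.
  rewrite partial_cst sub0r -[RHS]oppr0; congr (- _).
  rewrite (eq_slot_sum (A' := fun f b => christoffel G u f x b)
      (T' := fun s => 0 * 0)) //; first by rewrite slot_sumZr mul0r.
  by move=> [|z t] // _; rewrite mul0r dT.
have := nabla_comm_curvature a b [:: c; d] Uu C2T.
rewrite !ddT subrr !slot_sum_cons slot_sum_nil addr0 /= => /esym /eqP.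
rewrite addr_eq0 => /eqP e; rewrite /riemann_low.
under eq_bigr do rewrite riemannE //.
rewrite e; congr (- _); apply: eq_bigr => f _.
by rewrite riemannE // (symG Uu).
Qed.

Lemma ricci_identity T u c a s : U u -> (forall s, Cn 2 U (T ^~ s)) ->
  nabla G (nabla G T) u [:: c, a & s] - nabla G (nabla G T) u [:: a, c & s] =
  slot_sum (fun f e => \sum_k ginv G u f k * riemann_low G u c a e k) (T u) s.
Proof.
move=> Uu C2T; rewrite nabla_comm_curvature //; apply: eq_slot_sum => // f e.
rewrite /riemann_low; under eq_bigr do rewrite mulr_sumr.
rewrite exchange_big (bigD1 f) //= [X in _ + X]big1 => [|j /negPf nj].
  under eq_bigr do rewrite mulrCA (symG Uu).
  by rewrite -mulr_sumr ginvK // eqxx mulr1 addr0 riemannE.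
under eq_bigr do rewrite mulrCA (symG Uu).
by rewrite -mulr_sumr ginvK // eq_sym nj mulr0.
Qed.

Lemma nabla_skew T u c : U u -> (forall v, U v -> skew_seq (T v)) ->
  (forall s, pderivable c (T ^~ s) u) ->
  skew_seq (fun s => nabla G T u (c :: s)).
Proof.
move=> Uu skT dT s1 x y s2; rewrite /nabla (slot_sum_skew _ (skT u Uu)).
rewrite (@eq_partial _ _ U u c _ (fun v => - T v (s1 ++ [:: y, x & s2]))) //.
  by rewrite (partialN (dT _)) -opprD.
by move=> v Uv; exact: skT.
Qed.

Lemma nabla_nabla_skew T u c a : U u -> (forall v, U v -> skew_seq (T v)) ->
  (forall s, Cn 2 U (T ^~ s)) ->
  skew_seq (fun s => nabla G (nabla G T) u [:: c, a & s]).
Proof.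
move=> Uu skT C2T s1 x y s2.
have skN b v : U v -> skew_seq (fun s => nabla G T v (b :: s)).
  by move=> Uv; apply: nabla_skew => // s; exact: Cn2_pderivable.
rewrite {1 3}/nabla !slot_sum_cons.
rewrite (@eq_partial _ _ U u c _
  (fun v => - nabla G T v (a :: s1 ++ [:: y, x & s2]))) //; last first.
  by move=> v Uv; exact: skN.
have dN : pderivable c (fun v => nabla G T v (a :: s1 ++ [:: y, x & s2])) u.
  exact: pderivable_nabla.
rewrite (partialN dN) (slot_sum_skew _ (skN a u Uu)).
under eq_bigr do rewrite (skN _ u Uu) mulrN.
by rewrite sumrN -!opprD.
Qed.

(** The left side is the covariant derivative of the antisymmetrized product of g and h, written
    out. By the Leibniz rule and nabla g = 0, only the derivative of h remains. *)
Lemma nabla_altsum_metric (h : 'rV[R]_n -> seq 'I_n -> R) u c a s : U u ->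
  (forall t, pderivable c (h ^~ t) u) ->
  pderivable c (fun v => altsum (fun y t => G v a y * h v t) s) u /\
  partial c (fun v => altsum (fun y t => G v a y * h v t) s) u
  - (\sum_f christoffel G u f c a * altsum (fun y t => G u f y * h u t) s
     + slot_sum (fun f b => christoffel G u f c b)
         (altsum (fun y t => G u a y * h u t)) s) =
  altsum (fun y t => G u a y * nabla G h u (c :: t)) s.
Proof.
move=> Uu dh.
have dG y : pderivable c (fun v => G v a y) u by exact: Cn2_pderivable.
have [|d e] := @partial_altsumP _ _ c (fun v y t => G v a y * h v t) u s.
  by move=> y t; exact: (pderivableM (dG y) (dh t)).
split=> //; rewrite e slot_sum_altsum_mul.
under [X in _ - (X + _)]eq_bigr do rewrite -altsumZ.
rewrite -altsum_sum -!altsumD -altsumB; apply: eq_altsum => y t _.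
rewrite (partialM (dG y) (dh t)) metric_compat //.
under [X in _ - (X + _)]eq_bigr do rewrite mulrA.
rewrite -mulr_suml /nabla.
have cancel (x0 x1 x2 x3 x4 x5 : R) : (x0 + x1) * x2 + x3 * x4
    - (x0 * x2 + (x1 * x2 + x3 * x5)) = x3 * (x4 - x5) by ring.
exact: cancel.
Qed.

Lemma nabla_CKY (Y h : 'rV[R]_n -> seq 'I_n -> R) (kappa : R) u : U u ->
  (forall s, Cn 2 U (Y ^~ s)) -> (forall c t, pderivable c (h ^~ t) u) ->
  (forall v a b s, U v ->
     nabla G Y v [:: a, b & s] + nabla G Y v [:: b, a & s] =
     kappa * (altsum (fun y t => G v a y * h v t) (b :: s)
              + altsum (fun y t => G v b y * h v t) (a :: s))) ->
  forall c a b s,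
  nabla G (nabla G Y) u [:: c, a, b & s] + nabla G (nabla G Y) u [:: c, b, a & s] =
  kappa * (altsum (fun y t => G u a y * nabla G h u (c :: t)) (b :: s)
           + altsum (fun y t => G u b y * nabla G h u (c :: t)) (a :: s)).
Proof.
move=> Uu C2Y dh CKY c a b s.
pose W v x := altsum (fun y t => G v x y * h v t).
have dN x t : pderivable c (fun v => nabla G Y v (x :: t)) u by exact: pderivable_nabla.
have [dWa <-] := nabla_altsum_metric a (b :: s) Uu (dh c).
have [dWb <-] := nabla_altsum_metric b (a :: s) Uu (dh c).
pose Gm f e := christoffel G u f c e.
have p : partial c (fun v => nabla G Y v [:: a, b & s]) u
    + partial c (fun v => nabla G Y v [:: b, a & s]) u =
    kappa * (partial c (fun v => W v a (b :: s)) u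
             + partial c (fun v => W v b (a :: s)) u).
  rewrite -(partialD (dN _ _) (dN _ _)) -(partialD dWa dWb).
  rewrite (@eq_partial _ _ U u c _
    (fun v => kappa * (W v a (b :: s) + W v b (a :: s)))) //; last first.
    by move=> v Uv; exact: CKY.
  rewrite (partialM (@pderivable_cst R n c kappa u) (pderivableD dWa dWb)).
  by rewrite partial_cst mul0r add0r.
(* The connection term of one index is collected from both orders of that index and its partner;
   only this crosswise pair is again an instance of the CKY equation. *)
have q x y : \sum_f Gm f x * nabla G Y u [:: f, y & s]
    + \sum_f Gm f x * nabla G Y u [:: y, f & s] =
    kappa * (\sum_f Gm f x * W u f (y :: s) + \sum_f Gm f x * W u y (f :: s)).
  rewrite -!big_split mulr_sumr; apply: eq_bigr => f _ /=.
  by rewrite -!mulrDr CKY // mulrCA.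
have r : slot_sum Gm (fun t => nabla G Y u [:: a, b & t]) s
    + slot_sum Gm (fun t => nabla G Y u [:: b, a & t]) s =
    kappa * (slot_sum Gm (fun t => W u a (b :: t)) s
             + slot_sum Gm (fun t => W u b (a :: t)) s).
  rewrite -!slot_sumDr -slot_sumZr; apply: eq_slot_sum => // t _.
  exact: CKY.
have combine (p1 p2 q1 q2 q3 q4 r1 r2 : R) (P1 P2 Q1 Q2 Q3 Q4 S1 S2 : R) :
    p1 + p2 = kappa * (P1 + P2) -> q1 + q2 = kappa * (Q1 + Q2) ->
    q3 + q4 = kappa * (Q3 + Q4) -> r1 + r2 = kappa * (S1 + S2) ->
    p1 - (q1 + (q4 + r1)) + (p2 - (q3 + (q2 + r2))) =
    kappa * ((P1 - (Q1 + (Q4 + S1))) + (P2 - (Q3 + (Q2 + S2)))).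
  move=> e1 e2 e3 e4.
  transitivity ((p1 + p2) - (q1 + q2) - (q3 + q4) - (r1 + r2)); first by ring.
  by rewrite e1 e2 e3 e4; ring.
rewrite {1 3}/nabla !slot_sum_cons.
exact: (combine _ _ _ _ _ _ _ _ _ _ _ _ _ _ _ _ p (q a b) (q b a) r).
Qed.

End ChartCalculus.

(** * Weyl tensor and the main identity *)

Section AlgebraicCurvature.
Variables (R : realType) (n : nat).
Implicit Types (K : 'I_n -> 'I_n -> 'I_n -> 'I_n -> R).

(** The classical octahedron argument: the four Bianchi identities, each with a different last
    index, are added up with signs. *)
Lemma curvature_pair_sym K :
  (forall a b c d, K a b c d = - K b a c d) ->
  (forall a b c d, K a b c d = - K a b d c) ->
  (forall a b c d, K a b c d + K b c a d + K c a b d = 0) ->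
  forall a b c d, K a b c d = K c d a b.
Proof.
move=> Nl Nr B a b c d.
have := B a b c d; have := B b c d a; have := B c d a b; have := B d a b c.
have := Nr b c d a; have := Nr c d b a; have := Nl d b c a; have := Nr b d c a.
have := Nl d a c b; have := Nr a d c b; have := Nr a c d b; have := Nl c a b d.
have := Nl d a b c; have := Nr a b d c; lra.
Qed.

Variables (G Gi : 'I_n -> 'I_n -> R) (Y : seq 'I_n -> R).
Hypothesis symG : forall a b, G a b = G b a.
Hypothesis symGi : forall a b, Gi a b = Gi b a.
Hypothesis GiK : forall a b, \sum_k Gi a k * G k b = (a == b)%:R.
Hypothesis skY : skew_seq Y.

(* The Schouten part of the curvature is absorbed by a shift of S. *)
Lemma weyl_part_identity K C P (S : 'I_n -> 'I_n -> seq 'I_n -> R) (kappa : R)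
    a c b d E :
  kappa != 0 -> (forall x y, P x y = P y x) ->
  (forall x y z w, K x y z w = C x y z w + kn G P x y z w) ->
  curv_op Gi Y K a c b d E + kappa * metric_op G S a c b d E = 0 ->
  curv_op Gi Y C a c b d E
  + kappa * metric_op G (fun x y s => S x y s
      - kappa^-1 * (contr1 Gi Y P x y s + contr1 Gi Y P y x s)) a c b d E = 0.
Proof.
move=> k0 symP eqK.
rewrite (curv_opD Gi Y a c b d E eqK) curv_op_kn //.
set SP := fun x y s => contr1 Gi Y P x y s + _.
set S' := fun x y s => S x y s - _.
rewrite (@metric_opD _ _ G S S' (fun x y s => kappa^-1 * SP x y s)); last first.
  by move=> x y s; rewrite /S' /SP subrK.
rewrite metric_opZ mulrDr mulrA divff // mul1r => e.
by rewrite -[RHS]e; ring.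
Qed.

End AlgebraicCurvature.

(** * Ricci decomposition and symmetries of the Weyl tensor *)

Section WeylDecomposition.
Variables (R : realType) (n : nat) (G : 'rV[R]_n -> 'M[R]_n) (u : 'rV[R]_n).
Hypothesis n2 : (2 < n)%N.
Hypothesis symG : forall a b, G u a b = G u b a.
Hypothesis symGi : forall a b, ginv G u a b = ginv G u b a.
Hypothesis GiK : forall a b, \sum_k ginv G u a k * G u k b = (a == b)%:R.
Let K := riemann_low G u.
Hypothesis KNr : forall a b c d, K a b c d = - K a b d c.
Hypothesis Kbianchi : forall a b c d, K a b c d + K b c a d + K c a b d = 0.

Let KNl a b c d : K a b c d = - K b a c d.
Proof. exact: riemann_low_skewl. Qed.

Let Kpair a b c d : K a b c d = K c d a b.
Proof. exact: curvature_pair_sym. Qed.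

Let n1_neq0 : n%:R - 1 != 0 :> R.
Proof. by rewrite subr_eq0 pnatr_eq1; lia. Qed.

Let n2_neq0 : n%:R - 2 != 0 :> R.
Proof. by rewrite subr_eq0 eqr_nat; lia. Qed.

Definition schouten a b : R :=
  (n%:R - 2)^-1 * ricci G u a b
  - scalar_curvature G u / (2 * ((n%:R - 1) * (n%:R - 2))) * G u a b.

Lemma ricci_ctr b d : ricci G u b d = ctr (ginv G u) (fun a c => K a b c d).
Proof. by rewrite ctr_swap. Qed.

Lemma ricci_sym a b : ricci G u a b = ricci G u b a.
Proof.
by rewrite !ricci_ctr ctr_swap //; apply: eq_ctr => c d; rewrite Kpair.
Qed.

Lemma schouten_sym a b : schouten a b = schouten b a.
Proof. by rewrite /schouten ricci_sym symG. Qed.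

Lemma riemann_weyl a b c d : K a b c d = weyl G u a b c d + kn (G u) schouten a b c d.
Proof.
rewrite /weyl /kn /schouten -/(K a b c d).
rewrite (ricci_sym d b) (ricci_sym c b) (ricci_sym d a) (ricci_sym c a).
rewrite (symG d b) (symG c b).
move: n1_neq0 n2_neq0; move: (n%:R : R) => m m1 m2.
move: (K a b c d) (scalar_curvature G u) (ricci G u b d) (ricci G u b c).
move: (ricci G u a d) (ricci G u a c) => r1 r2 k s r3 r4.
by field; rewrite m1 m2.
Qed.

Lemma weylE a b c d : weyl G u a b c d = K a b c d - kn (G u) schouten a b c d.
Proof. by rewrite riemann_weyl addrK. Qed.

Lemma weyl_skewl a b c d : weyl G u a b c d = - weyl G u b a c d.
Proof. by rewrite !weylE KNl /kn; ring. Qed.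

Lemma weyl_skewr a b c d : weyl G u a b c d = - weyl G u a b d c.
Proof. by rewrite !weylE KNr /kn; ring. Qed.

Lemma weyl_bianchi a b c d :
  weyl G u a b c d + weyl G u b c a d + weyl G u c a b d = 0.
Proof.
rewrite !weylE -[RHS](Kbianchi a b c d) /kn.
rewrite (symG b a) (symG c a) (symG c b).
by rewrite (schouten_sym b a) (schouten_sym c a) (schouten_sym c b); ring.
Qed.

Lemma weyl_pair a b c d : weyl G u a b c d = weyl G u c d a b.
Proof.
exact: (curvature_pair_sym weyl_skewl weyl_skewr weyl_bianchi).
Qed.

(** The trace of [kn P] is (n - 2) P + (tr P) g, and the normalization of the Schouten tensor makes
    this the Ricci tensor. *)
Lemma weyl_trace b d : ctr (ginv G u) (fun a c => weyl G u a b c d) = 0.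
Proof.
have trS : ctr (ginv G u) schouten = scalar_curvature G u / (2 * (n%:R - 1)).
  have rE : ctr (ginv G u) (ricci G u) = scalar_curvature G u by [].
  rewrite /schouten ctrB !ctrZ rE (ctr_dim symG GiK).
  move: n1_neq0 n2_neq0; move: (n%:R : R) => m m1 m2.
  by move: (scalar_curvature G u) => s; field; rewrite m1 m2.
under eq_ctr do rewrite weylE.
rewrite ctrB -ricci_ctr /kn ctrD !ctrB.
have t1 : ctr (ginv G u) (fun a c => G u a c * schouten b d) = n%:R * schouten b d.
  by rewrite ctrZr (ctr_dim symG GiK).
have t2 : ctr (ginv G u) (fun a c => G u a d * schouten b c) = schouten b d.
  by under eq_ctr do rewrite symG; exact: ctr_metric.
have t3 : ctr (ginv G u) (fun a c => G u b c * schouten a d) = schouten b d.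
  under eq_ctr do rewrite mulrC.
  exact: (ctr_metricr symG GiK b (schouten ^~ d)).
have t4 : ctr (ginv G u) (fun a c => G u b d * schouten a c) =
    G u b d * (scalar_curvature G u / (2 * (n%:R - 1))).
  by rewrite ctrZ trS.
rewrite t1 t2 t3 t4 /schouten.
move: n1_neq0 n2_neq0; move: (n%:R : R) => m m1 m2.
move: (scalar_curvature G u) (ricci G u b d) (G u b d) => s r g.
by field; rewrite m1 m2.
Qed.

End WeylDecomposition.

Section SkewSeqLinear.
Variables (R : realType) (n : nat).
Implicit Types T : seq 'I_n -> R.

Lemma skew_seqD T T' :
  skew_seq T -> skew_seq T' -> skew_seq (fun s => T s + T' s).
Proof. by move=> skT skT' s1 x y s2; rewrite skT skT' opprD. Qed.

Lemma skew_seqN T : skew_seq T -> skew_seq (fun s => - T s).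
Proof. by move=> skT s1 x y s2; rewrite skT. Qed.

Lemma skew_seqZ k T : skew_seq T -> skew_seq (fun s => k * T s).
Proof. by move=> skT s1 x y s2; rewrite skT mulrN. Qed.

End SkewSeqLinear.

Section WeylIdentity.
Variables (R : realType) (n : nat) (U : set 'rV[R]_n) (G : 'rV[R]_n -> 'M[R]_n).
Hypothesis openU : open U.
Hypothesis symG : forall v, U v -> forall a b, G v a b = G v b a.
Hypothesis C2G : forall a b, Cn 2 U (fun v => G v a b).
Hypothesis Gunit : forall v, U v -> G v \in unitmx.

Lemma CKY_weyl_identity (q : nat) (Y h : 'rV[R]_n -> seq 'I_n -> R) u :
  (q.+2 < n)%N -> U u ->
  (forall v, U v -> skew_seq (Y v)) -> (forall s, Cn 2 U (Y ^~ s)) ->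
  (forall v, U v -> skew_seq (h v)) -> (forall s, Cn 2 U (h ^~ s)) ->
  (forall v a b s, U v ->
     nabla G Y v [:: a, b & s] + nabla G Y v [:: b, a & s] =
     2 / q.+2%:R * (altsum (fun y t => G v a y * h v t) (b :: s)
              + altsum (fun y t => G v b y * h v t) (a :: s))) ->
  exists S : 'I_n -> 'I_n -> seq 'I_n -> R,
  [/\ forall x y s, S x y s = S y x s, forall x y, skew_seq (S x y),
      forall x y s, size s = q -> S x y s =
        q.+2%:R / (2 * (n%:R - q.+2%:R)) *
        (2^-1 * (altsum (hook_term (ginv G u) (Y u) (weyl G u) x y) s
                 + altsum (hook_term (ginv G u) (Y u) (weyl G u) y x) s)) &
      forall a c b d s,
        curv_op (ginv G u) (Y u) (weyl G u) a c b d s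
        + 2 / q.+2%:R * metric_op (G u) S a c b d s = 0].
Proof.
move=> qn Uu skY C2Y skh C2h CKY.
have n2 : (2 < n)%N by lia.
have k0 : 2 / q.+2%:R != 0 :> R by rewrite mulf_neq0 ?invr_eq0 ?pnatr_eq0.
have sG := symG Uu; have sGi := ginv_sym symG Uu; have GiK := ginvK Gunit Uu.
have Rr a b c d := riemann_low_skewr openU symG C2G Gunit a b c d Uu.
have Rb a b c d := riemann_low_bianchi openU symG C2G Gunit a b c d Uu.
pose H c s := nabla G h u (c :: s).
have dh c t : pderivable c (h ^~ t) u by exact: Cn2_pderivable.
have skH c : skew_seq (H c) by exact: (nabla_skew _ openU Uu skh (dh c)).
have skD2 c a := nabla_nabla_skew openU C2G Gunit c a Uu skY C2Y.
pose SP x y s := contr1 (ginv G u) (Y u) (schouten G u) x y s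
               + contr1 (ginv G u) (Y u) (schouten G u) y x s.
(* The symmetrized derivative of h, shifted by p/2 times the symmetrized contraction of the Schouten
   tensor with [Y]. *)
pose S x y s := H x (y :: s) + H y (x :: s) - (2 / q.+2%:R)^-1 * SP x y s.
have skc x y : skew_seq (contr1 (ginv G u) (Y u) (schouten G u) x y).
  move=> s1 z w s2; rewrite /contr1 -ctrN; apply: eq_ctr => k f.
  by rewrite (skY u Uu (y :: f :: s1)) mulrN.
have skS x y : skew_seq (S x y).
  apply: skew_seqD; last by apply/skew_seqN/skew_seqZ/skew_seqD.
  by apply: skew_seqD; apply: skew_seq_cons.
have idS a c b d s : curv_op (ginv G u) (Y u) (weyl G u) a c b d s
        + 2 / q.+2%:R * metric_op (G u) S a c b d s = 0.
  apply: (weyl_part_identity sG sGi GiK (skY u Uu) k0).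
  - exact: schouten_sym.
  - exact: riemann_weyl.
  apply: (prolongation_identity sG sGi (skY u Uu) _ skH skD2) => //.
  - exact: riemann_low_skewl.
  - exact: (nabla_CKY openU symG C2G Gunit Uu C2Y dh CKY).
  - move=> c' a' s'; exact: (ricci_identity openU symG C2G Gunit).
have symS x y t : S x y t = S y x t by rewrite /S /SP; ring.
exists S; split=> // x y s szs.
apply: (metric_op_unique sG sGi GiK (skY u Uu) _ _ _ _ _ qn (erefl _) symS skS) => //.
- exact: weyl_skewl.
- exact: weyl_skewr.
- exact: weyl_bianchi.
- exact: weyl_pair.
- exact: weyl_trace.
Qed.

End WeylIdentity.

(** * Components at index lists of the wrong length *)

Section Restriction.
Variables (R : realType) (n : nat).

(* Vanishing on index lists of the wrong length makes skewness unconditional. *)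
Definition restrict_size k (T : seq 'I_n -> R) s := if size s == k then T s else 0.

Lemma restrict_size_skew k (T : seq 'I_n -> R) :
  (forall (B : k.-tuple 'I_n) (s : 'S_k),
     T [tuple tnth B (s m) | m < k] = (-1) ^+ s * T B) ->
  skew_seq (restrict_size k T).
Proof.
move=> skT s1 x y s2; rewrite /restrict_size.
have -> : size (s1 ++ [:: y, x & s2]) = size (s1 ++ [:: x, y & s2]).
  by rewrite !size_cat.
case: eqP => [sz|]; last by rewrite oppr0.
have ik : (size s1 < k)%N by rewrite -sz size_cat /=; lia.
have jk : ((size s1).+1 < k)%N by rewrite -sz size_cat /=; lia.
pose B : k.-tuple 'I_n := Tuple (introT eqP sz).
pose i := Ordinal ik; pose j := Ordinal jk.
have ij : i != j by rewrite -val_eqE /= neq_ltn ltnSn.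
have := skT B (tperm i j); rewrite odd_tperm ij expr1 mulN1r /=.
rewrite (_ : [tuple _ | m < k] = s1 ++ [:: y, x & s2] :> seq _).
  by move=> ->; rewrite opprK.
apply: (@eq_from_nth _ x) => [|m].
  by rewrite size_tuple -sz !size_cat.
rewrite size_tuple => mk; pose o := Ordinal mk.
rewrite -[m]/(val o) -tnth_nth tnth_mktuple (tnth_nth x) /=.
case: tpermP => [/(congr1 val) /= ->|/(congr1 val) /= ->|/eqP oi /eqP oj].
- by rewrite !nth_cat /= ltnn ltnNge leqnSn /= subnn subSnn.
- by rewrite !nth_cat /= ltnn ltnNge leqnSn /= subnn subSnn.
move: oi oj; rewrite -!val_eqE /= => oi oj; rewrite !nth_cat.
case: ltnP => // le; have [l ml] : exists l, m = (size s1 + l.+2)%N.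
  by exists (m - size s1 - 2)%N; lia.
by rewrite /= ml addKn.
Qed.

Lemma nabla_restrict_size k (G : 'rV[R]_n -> 'M[R]_n)
    (T : 'rV[R]_n -> seq 'I_n -> R) u a s :
  nabla G (fun v => restrict_size k (T v)) u (a :: s) =
  if size s == k then nabla G T u (a :: s) else 0.
Proof.
rewrite /nabla /restrict_size; case: eqP => sz.
  congr (_ - _); apply: eq_slot_sum => // t ->.
  by rewrite sz eqxx.
rewrite partial_cst sub0r -[RHS]oppr0; congr (- _).
rewrite (eq_slot_sum (A' := fun f b => christoffel G u f a b)
  (T' := fun s => 0 * 0)) //; first by rewrite slot_sumZr mul0r.
by move=> t ->; rewrite mul0r; case: eqP.
Qed.

Lemma altsum_restrict_size k (phi : 'I_n -> R) T s : size s != k.+1 ->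
  altsum (fun y t => phi y * restrict_size k T t) s = 0.
Proof.
move=> sz; rewrite -[RHS](altsum0 _ s); apply: eq_altsum => y t st.
by rewrite /restrict_size -eqSS st (negPf sz) mulr0.
Qed.

End Restriction.

(** Of the head terms, four share each index w on [Y]; antisymmetrized in b and c they become three
    times a single one by the first Bianchi identity. The block terms need only their two skew
    symmetries. *)
Lemma curvature_combination (R : realType) (n : nat)
    (hd A : 'I_n -> 'I_n -> 'I_n -> 'I_n -> R) a b c d :
  (forall x y z w, hd x y z w = - hd y x z w) ->
  (forall x y z w, hd x y z w + hd y z x w + hd z x y w = 0) ->
  (forall x y z w, A x y z w = - A y x z w) ->
  (forall x y z w, A x y z w = - A x y w z) ->
  let cv a c b d := hd b c d a + hd d c b a + hd b a d c + hd d a b c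
    + hd a d c b + hd c d a b + hd a b c d + hd c b a d
    - (A c b a d + A a b c d + A c d a b + A a d c b) in
  - hd c b a d - hd d a b c - hd a d c b - hd b c d a
  + alt3 (fun x y z => - A x y z a) b c d
  + 2 * alt3 (fun x y z => - A a x y z) b c d
  + 2 * - A b c a d - 3 * alt3 (fun x y z => - A x y z d) a b c =
  - 3^-1 * (cv a c b d - cv a b c d).
Proof.
move=> hN hB AN ANr cv; rewrite !alt3E /cv.
have Ha : - hd b c d a = - 3^-1 * (hd b c d a + hd d c b a - hd c b d a - hd d b c a).
  have := hB b c d a; have := hN b c d a; have := hN c d b a; have := hN d b c a; lra.
have Hb : - hd a d c b = - 3^-1 * (hd a d c b + hd c d a b - hd c a d b - hd d a c b).
  have := hB a d c b; have := hN c d a b; have := hN d a c b; lra.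
have Hc : - hd d a b c = - 3^-1 * (hd b a d c + hd d a b c - hd a d b c - hd b d a c).
  have := hB d a b c; have := hN b a d c; have := hN a d b c; lra.
have Hd : - hd c b a d = - 3^-1 * (hd a b c d + hd c b a d - hd a c b d - hd b c a d).
  have := hB a b c d; have := hN a b c d; have := hN b c a d; have := hN c a b d; lra.
rewrite (AN c b d a) (AN d b c a) (AN d c b a) (AN b a c d) (AN c a b d).
rewrite (AN c b a d) (ANr b c d a) (ANr b d c a) (ANr c d b a) (ANr a b d c).
rewrite (ANr a c d b) (ANr a d c b).
by move: Ha Hb Hc Hd; lra.
Qed.

Lemma ctr_contract2 (R : realType) (n : nat) (Gi : 'I_n -> 'I_n -> R)
    (symGi : forall a b, Gi a b = Gi b a) (A T : 'I_n -> 'I_n -> R) :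
  \sum_e \sum_f (\sum_k \sum_l Gi e k * Gi f l * A k l) * T e f =
  ctr Gi (fun k e => ctr Gi (fun l f => A k l * T e f)).
Proof.
have inner e : \sum_f (\sum_k \sum_l Gi e k * Gi f l * A k l) * T e f =
    ctr Gi (fun l f => (\sum_k Gi e k * A k l) * T e f).
  rewrite -(ctr_contract symGi); apply: eq_bigr => f _; congr (_ * _).
  rewrite exchange_big; apply: eq_bigr => l _; rewrite mulr_sumr.
  by apply: eq_bigr => k _; rewrite mulrCA mulrA.
under eq_bigr do rewrite inner.
rewrite ctr_exchange /ctr exchange_big; apply: eq_bigr => l _.
rewrite exchange_big; apply: eq_bigr => f _.
by rewrite -mulr_sumr (ctr_contract symGi (A ^~ l) (T ^~ f)).
Qed.

Theorem mainTheorem1 (R : realType) (n : nat) (M : smoothManifold R n)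
  (g : metric M) (p : nat) (hp : (2 <= p < n)%N)
  (Y : tensorField M p) (hY : is_CKY g Y)
  (i : chart M) (u : 'rV[R]_n) (hu : cimg i u)
  (a b c d : 'I_n) (E : (p - 2).-tuple 'I_n) :
  let G := metric_mx g i in
  let gg x y := G u x y in
  let W := Wtensor G p u (Y i u) in
  (* C^f_{xyz} Y_{wfE} *)
  let CY x y z w := \sum_(f < n) weyl_up1 G u f x y z * Y i u (w :: f :: E) in
  (* C^{\hat f}_{\hat e xy} Y_{zw \hat F} *)
  let CYhat x y z w :=
    slot_sum (fun f e => weyl_up1 G u f e x y)
             (fun F => Y i u (z :: w :: F)) E in
  (* W_{xyz[e_4 ... e_p} g_{e_3]w} *)
  let Wg x y z w :=
    alt (fun s => if s is e :: s'
                  then W x y (z :: belast e s') * gg (last e s') w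
                  else 0) (rot 1 E) in
  0 = CY a c b d + CY b d a c + CY c a d b + CY d b c a
      + alt3 (fun x y z => CYhat x y z a) b c d
      + 2 * alt3 (fun x y z => CYhat a x y z) b c d
      + 2 * CYhat b c a d
      - 3 * alt3 (fun x y z => CYhat x y z d) a b c
      + 2 / p%:R * (gg a c * W b d E + gg b d * W a c E
                    - gg a b * W c d E - gg c d * W a b E)
      + 2 * (p%:R - 2) / (3 * p%:R) *
        (Wg d c b a - Wg d b c a + Wg c d a b - Wg c a d b
         + Wg b a d c - Wg b d a c + Wg a b c d - Wg a c b d).
Proof.
case: p hp Y hY E => [|[|q]] // /andP[_ qn] Y [skYt [h [skht CKYt]]] E.
move=> G gg W CY CYhat Wg.
have szE : size E = q by rewrite size_tuple subSS subn1.
(* Components at lists of other lengths are arbitrary; setting them to zero makes skewness,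
   differentiability and the CKY equation hold for every list. *)
pose Y' v := restrict_size q.+2 (Y i v).
pose h' v := restrict_size q.+1 (h i v).
have oU : open (cimg i) by exact: cimg_open.
have symG v : cimg i v -> forall x y, G v x y = G v y x.
  by move=> Uv x y; rewrite !mxE (Defs.metric_sym g Uv).
have C2G x y : Cn 2 (cimg i) (fun v => G v x y).
  rewrite (_ : (fun v => _) = fun v => g i v [tuple x; y]).
    exact: comp_smooth.
  by apply/funext => v; rewrite mxE.
have Gunit v : cimg i v -> G v \in unitmx by exact: metric_nondegenerate.
have C2r k (T : tensorField M k) s :
    Cn 2 (cimg i) (fun v => restrict_size k (T i v) s).
  rewrite /restrict_size; case: eqP => [sz|_]; last exact: Cn_cst.
  exact: (comp_smooth T i (Tuple (introT eqP sz)) 2).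
have skY' v : cimg i v -> skew_seq (Y' v).
  by move=> Uv; apply: restrict_size_skew => B s; exact: skYt.
have skh' v : cimg i v -> skew_seq (h' v).
  by move=> Uv; apply: restrict_size_skew => B s; exact: skht.
(* Weight one over p = q + 2 indices leaves the factor 1/p, whence the constant 2/p in the CKY
   equation below. *)
have altE v x y (s : seq 'I_n) : cimg i v -> size s = q.+1 ->
    alt (fun t => if t is z :: t' then g i v [:: x; z] * h i v t' else 0) (y :: s) =
    q.+2%:R^-1 * altsum (fun z t => G v x z * h' v t) (y :: s).
  move=> Uv sz; rewrite -[in RHS]sz -(alt_mul_skew (fun z => G v x z)); last exact: skh'.
  apply: eq_alt => -[|z t] //= [szt]; rewrite /h' /restrict_size szt sz eqxx.
  by rewrite mxE.
have CKY v x y s : cimg i v ->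
    nabla G Y' v [:: x, y & s] + nabla G Y' v [:: y, x & s] =
    2 / q.+2%:R * (altsum (fun z t => G v x z * h' v t) (y :: s)
              + altsum (fun z t => G v y z * h' v t) (x :: s)).
  move=> Uv; rewrite !nabla_restrict_size ![size (_ :: s)]/= eqSS.
  case: eqP => sz; last first.
    have sz' z : size (z :: s) != q.+2 by apply/eqP => -[/sz].
    by rewrite !altsum_restrict_size // !addr0 mulr0.
  transitivity (2 * alt (fun t => if t is z :: t' then g i v [:: x; z] * h i v t'
      else 0) (y :: s) + 2 * alt (fun t => if t is z :: t' then
      g i v [:: y; z] * h i v t' else 0) (x :: s)).
    exact: (CKYt _ _ Uv x y (Tuple (introT eqP sz))).
  by rewrite !altE // !mulrA -mulrDr.
have [S [symS skS SE idS]] := CKY_weyl_identity oU symG C2G Gunit qn hu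
  skY' (C2r _ Y) skh' (C2r _ h) CKY.
have symGi := ginv_sym symG hu.
have skYu := skY' u hu.
have WE x y (s : seq 'I_n) : size s = q -> W x y s = S x y s.
  move=> szs; rewrite SE // /W /Wtensor; congr (_ * (_ * _)).
  have hookE z w : \sum_(e < n) slot_sum (fun f e' => weyl_up2 G u e f e' z)
      (fun F => Y i u (w :: e :: F)) s =
      altsum (hook_term (ginv G u) (Y' u) (weyl G u) z w) s.
    have -> : \sum_(e < n) slot_sum (fun f e' => weyl_up2 G u e f e' z)
        (fun F => Y i u (w :: e :: F)) s =
      \sum_(e < n) altsum (fun e' t => \sum_f weyl_up2 G u e f e' z *
         Y' u (w :: e :: f :: t)) s.
      apply: eq_bigr => e _.
      have skwe : skew_seq (fun F => Y' u (w :: e :: F)).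
        exact: (skew_seq_cons e (skew_seq_cons w skYu)).
      rewrite -(slot_sum_altsum _ _ skwe); apply: eq_slot_sum => // t szt.
      by rewrite /Y' /restrict_size /= szt szs eqxx.
    rewrite -altsum_sum; apply: eq_altsum => e' t _.
    exact: (ctr_contract2 symGi (fun k l => weyl G u k l e' z)
                          (fun e f => Y' u [:: w, e, f & t])).
  by rewrite !hookE.
have n2 : (2 < n)%N by lia.
have sG := symG u hu; have GiK := ginvK Gunit hu.
have Rr x y z w := riemann_low_skewr oU symG C2G Gunit x y z w hu.
have Rb x y z w := riemann_low_bianchi oU symG C2G Gunit x y z w hu.
have Cl x y z w : weyl G u x y z w = - weyl G u y x z w by exact: weyl_skewl.
have Cp x y z w : weyl G u x y z w = weyl G u z w x y by exact: weyl_pair.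
have Cr x y z w : weyl G u x y z w = - weyl G u x y w z by exact: weyl_skewr.
have Cb x y z w :
    weyl G u x y z w + weyl G u y z x w + weyl G u z x y w = 0.
  exact: weyl_bianchi.
pose hd x y z w := head_term (ginv G u) (Y' u) (weyl G u) x y z w E.
pose A x y z w := altsum (block_term (ginv G u) (Y' u) (weyl G u) x y z w) E.
pose sg w x y z := altsum (fun e t => G u w e * S x y (z :: t)) E.
(* The identity contracts the first index of C, [head_term] the last; pair symmetry followed by one
   transposition gives the sign. *)
have CYE x y z w : CY x y z w = - hd y z x w.
  rewrite /CY /hd /head_term -ctrN.
  have -> : \sum_(f < n) weyl_up1 G u f x y z * Y i u [:: w, f & E] =
      \sum_(f < n) weyl_up1 G u f x y z * Y' u [:: w, f & E].
    by apply: eq_bigr => f _; rewrite /Y' /restrict_size /= szE eqxx.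
  rewrite /weyl_up1 (ctr_contract symGi (fun k => weyl G u k x y z)).
  by apply: eq_ctr => k f; rewrite Cp Cr mulNr.
have CYhatE x y z w : CYhat x y z w = - A x y z w.
  have skzw : skew_seq (fun F => Y' u [:: z, w & F]).
    exact: (skew_seq_cons w (skew_seq_cons z skYu)).
  rewrite /CYhat (eq_slot_sum (A' := fun f e => weyl_up1 G u f e x y)
    (T' := fun F => Y' u [:: z, w & F])) //; last first.
    by move=> t szt; rewrite /Y' /restrict_size /= szt szE eqxx.
  rewrite (slot_sum_altsum _ _ skzw) /A -altsumN; apply: eq_altsum => e t _.
  rewrite /weyl_up1 (ctr_contract symGi (fun k => weyl G u k e x y)).
  by rewrite /block_term -ctrN; apply: eq_ctr => k f; rewrite Cp Cr mulNr.
(* The factor p - 2 = q of the bracket absorbs the weight 1/q of the antisymmetrization. For q = 0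
   both sides vanish, so no division is involved. *)
have WgE x y z w : q%:R * Wg x y z w = sg w x y z.
  rewrite /Wg /sg; move: (E : seq _) szE => s szs.
  pose F t := if t is e :: t' then G u w e * S x y (z :: t') else 0.
  rewrite (eq_alt (F' := fun t => F (rotr 1 t))); last first.
    move=> [|e t]; rewrite size_rot // szs => szt.
    have -> : rotr 1 (e :: t) = last e t :: belast e t by rewrite lastI rotr1_rcons.
    rewrite /F (sG w) mulrC; congr (_ * _); apply: WE.
    by rewrite /= size_belast.
  rewrite (alt_rot F) /F; case: s szs => [|e s] szs; first by rewrite -szs mul0r.
  rewrite (alt_mul_skew (G u w) _ _ (skew_seq_cons z (skS x y))).
  by rewrite -szs mulrA divff ?mul1r // pnatr_eq0.
have hN x y z w : hd x y z w = - hd y x z w.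
  by rewrite /hd -ctrN; apply: eq_ctr => k f; rewrite Cl mulNr.
have hB x y z w : hd x y z w + hd y z x w + hd z x y w = 0.
  rewrite /hd -!ctrD -[RHS](ctr0 (ginv G u)); apply: eq_ctr => k f.
  by rewrite -!mulrDl Cb mul0r.
have AN x y z w : A x y z w = - A y x z w.
  rewrite /A -altsumN; apply: eq_altsum => e t _.
  by rewrite /block_term -ctrN; apply: eq_ctr => k f; rewrite Cl mulNr.
have ANr x y z w : A x y z w = - A x y w z.
  rewrite /A -altsumN; apply: eq_altsum => e t _.
  rewrite /block_term -ctrN; apply: eq_ctr => k f.
  by rewrite (skew_seq_swap z w _ skYu) mulrN.
have mE x y z w : metric_op (G u) S x y z w E =
    G u x z * S y w E + G u x w * S z y E + G u y w * S x z E + G u z y * S x w E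
    - 2 * (G u z w * S x y E) - 2 * (G u x y * S z w E)
    + (sg y z w x + sg x z w y + sg z x y w + sg w x y z).
  by rewrite /metric_op !altsumD.
pose kappa : R := 2 / q.+2%:R.
have cvE x y z w : hd z y w x + hd w y z x + hd z x w y + hd w x z y
    + hd x w y z + hd y w x z + hd x z y w + hd y z x w
    - (A y z x w + A x z y w + A y w x z + A x w y z)
    = - (kappa * metric_op (G u) S x y z w E).
  apply/eqP; rewrite -addr_eq0; apply/eqP.
  by rewrite -[RHS](idS x y z w E) /curv_op !altsumD.
(* In the difference of the conditions for (a, c, b, d) and (a, b, c, d), the terms with [G a d] and
   [G b c] cancel by the symmetry of S, while the other four metric products acquire a factor 3 that
   compensates 1/3. *)
have comb := curvature_combination a b c d hN hB AN ANr.
rewrite /= !cvE !mE !alt3E in comb.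
have q2 : (q.+2%:R : R) = q%:R + 2 by rewrite -addn2 natrD.
have -> : 2 * (q.+2%:R - 2) / (3 * q.+2%:R) *
    (Wg d c b a - Wg d b c a + Wg c d a b - Wg c a d b
     + Wg b a d c - Wg b d a c + Wg a b c d - Wg a c b d) =
    3^-1 * (kappa * (sg a d c b - sg a d b c + sg b c d a - sg b c a d
      + sg c b a d - sg c b d a + sg d a b c - sg d a c b)).
  rewrite -!WgE /kappa q2 addrK; field.
  by rewrite -q2 pnatr_eq0.
rewrite !alt3E !CYE !CYhatE comb -/kappa.
have sgS w x y z : sg w x y z = sg w y x z.
  by apply: eq_altsum => e t _; rewrite symS.
rewrite !WE // (sgS a d c b) (sgS a d b c) (sgS b c a d) (sgS c b a d).
by rewrite (symS c b) (sG c b) /gg; field.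
Qed.
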